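(* Let $n\ge5$ and let $\mathcal M$ be a regular Cayley map on $D_n$ such that the unique cyclic subgroup of $L(D_n)$ of order $n$ is core-free in $\mathrm{Aut}(\mathcal M)$. Then $n=2m$ with $m$ odd, and $\mathcal M\equiv \mathrm{CM}(D_n,\,a\langle a^2\rangle\cup b\langle a^2\rangle,\,p)$ where $p=(b,a,a^2b,a^3,a^4b,\ldots,a^{n-2}b,a^{n-1})$, i.e. $p(a^jb)=a^{j+1}$ for even $j$ and $p(a^j)=a^{j+1}b$ for odd $j$.
   Context: $D_n=\langle a,b\mid a^n=b^2=baba=1\rangle$ is the dihedral group of order $2n$. For a finite group $G$, a generating subset $X\subseteq G$ with $X=X^{-1}$, $1_G\notin X$, and a cyclic permutation $p$ of $X$, the Cayley map $\mathrm{CM}(G,X,p)$ is the map with underlying Cayley graph $\mathrm{Cay}(G,X)$ (vertex set $G$, edges $\{g,gx\}$) and rotation $(g,gx)\mapsto(g,g\,p(x))$. A map automorphism is a permutation of darts commuting with the rotation and the dart-reversing involution; $\mathrm{Aut}(\mathcal M)$ is the group of these, and the map is regular if $\mathrm{Aut}(\mathcal M)$ is transitive on darts. $\mathrm{Aut}(\mathcal M)$ acts faithfully on the vertex set $G$ and is regarded as a permutation group on $G$; it contains $L(G)=\{L_g:g\in G\}$, $L_g(h)=gh$. A subgroup is core-free in a group if the largest normal subgroup of the group contained in it is trivial. Cayley maps $\mathrm{CM}(G_i,X_i,p_i)$ are equivalent ($\equiv$) if some group isomorphism $\phi:G_1\to G_2$ has $\phi(X_1)=X_2$ and $\phi p_1=p_2\phi$.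 *)

(* Defs.v *)
From HB Require Import structures.
From mathcomp Require Import all_boot all_order all_fingroup all_solvable.

Set Implicit Arguments.
Unset Strict Implicit.
Unset Printing Implicit Defensive.

Import GroupScope.

(* The rotation p is a permutation of the whole group fixing every element
   outside X, so that it is determined by its restriction to X. *)
Record cayley_map (gT : finGroupType) := CayleyMap {
  cm_set : {set gT};
  cm_perm : {perm gT};
  cm_gen : <<cm_set>> = [set: gT];
  cm_inv : cm_set^-1 = cm_set;
  cm_not1 : 1 \notin cm_set;
  cm_on : perm_on cm_set cm_perm;
  cm_cyclic : {in cm_set, forall x, porbit cm_perm x = cm_set}
}.
Arguments cayley_map gT%_type_scope.

Section CayleyMap.

Variables (gT : finGroupType) (M : cayley_map gT).

(* The pair (g, h) is a dart iff h = g * x for some x in the connection set. *)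
Definition dart := {d : gT * gT | d.1^-1 * d.2 \in cm_set M}.

Definition rot_pair (d : gT * gT) := (d.1, d.1 * cm_perm M (d.1^-1 * d.2)).

Definition rev_pair (d : gT * gT) := (d.2, d.1).

Lemma rot_pair_dart (d : dart) :
  (rot_pair (val d)).1^-1 * (rot_pair (val d)).2 \in cm_set M.
Proof. by rewrite /= mulKg (perm_closed _ (cm_on M)); apply: (valP d). Qed.

Lemma rev_pair_dart (d : dart) :
  (rev_pair (val d)).1^-1 * (rev_pair (val d)).2 \in cm_set M.
Proof.
by case: d => -[g h] /= gh; rewrite -(cm_inv M) inE invgM invgK.
Qed.

Definition dart_rot (d : dart) : dart := Sub (rot_pair (val d)) (rot_pair_dart d).
Definition dart_rev (d : dart) : dart := Sub (rev_pair (val d)) (rev_pair_dart d).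

Lemma dart_rot_inj : injective dart_rot.
Proof.
move=> [[g h] gh] [[g' h'] gh'] /(congr1 val) /= [] eg eh; apply: val_inj => /=.
by move: eh; rewrite -{}eg => /mulgI /perm_inj /mulgI <-.
Qed.

Lemma dart_rev_inj : injective dart_rev.
Proof.
move=> [[g h] gh] [[g' h'] gh'] /(congr1 val) /= [] eh eg.
by apply: val_inj; rewrite /= eg eh.
Qed.

Definition rot_perm : {perm dart} := perm dart_rot_inj.
Definition rev_perm : {perm dart} := perm dart_rev_inj.

(* The centraliser, in the symmetric group on the darts, of the rotation and
   of the dart-reversing involution. *)
Definition dart_aut : {group {perm dart}} := 'C([set rot_perm; rev_perm])%G.

Definition regular_map := [transitive dart_aut, on [set: dart] | 'P].

(* The automorphism group as a permutation group on the vertices: the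
   permutations s of gT induced by some automorphism phi of the map, which sends
   a dart based at g to a dart based at s g. *)
Definition vertex_aut : {set {perm gT}} :=
  [set s : {perm gT} | [exists phi in dart_aut,
              [forall d : dart, (val (phi d)).1 == s (val d).1]]].

Lemma vertex_aut_group_set : group_set vertex_aut.
Proof.
apply/group_setP; split=> [|s t].
  by rewrite inE; apply/exists_inP; exists 1; rewrite ?group1 //;
     apply/forallP=> d; rewrite !perm1.
rewrite !inE => /exists_inP[f Af /forallP sf] /exists_inP[g Ag /forallP tg].
apply/exists_inP; exists (f * g); first exact: groupM.
by apply/forallP=> d; rewrite !permM (eqP (tg _)) (eqP (sf _)).
Qed.
Canonical vertex_aut_group := Group vertex_aut_group_set.

End CayleyMap.

Definition left_mul (gT : finGroupType) (g : gT) : {perm gT} := perm (mulgI g).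

Definition left_regular (gT : finGroupType) : {set {perm gT}} :=
  [set left_mul g | g : gT].
Arguments left_regular gT%_type_scope.

Lemma left_regular_group_set (gT : finGroupType) :
  group_set (left_regular gT).
Proof.
apply/group_setP; split=> [|_ _ /imsetP[g _ ->] /imsetP[h _ ->]]; apply/imsetP.
  by exists 1 => //; apply/permP=> x; rewrite perm1 permE mul1g.
by exists (h * g) => //; apply/permP=> x; rewrite permM !permE mulgA.
Qed.
Canonical left_regular_group (gT : finGroupType) :=
  Group (left_regular_group_set gT).

Lemma left_regular_sub (gT : finGroupType) (M : cayley_map gT) :
  left_regular gT \subset vertex_aut M.
Proof.
apply/subsetP=> _ /imsetP[g _ ->].
have gP (d : dart M) : (g * (val d).1, g * (val d).2).1^-1
    * (g * (val d).1, g * (val d).2).2 \in cm_set M.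
  by rewrite /= invgM -mulgA mulKg; apply: (valP d).
pose f d : dart M := Sub (g * (val d).1, g * (val d).2) (gP d).
have f_inj : injective f.
  move=> [[x y] xy] [[x' y'] xy'] /(congr1 val) /= [].
  by move=> /mulgI ex /mulgI ey; apply: val_inj; rewrite /= ex ey.
rewrite inE; apply/exists_inP; exists (perm f_inj); last first.
  by apply/forallP=> d; rewrite !permE.
apply/centP=> _ /set2P[] ->; apply/permP=> d; apply: val_inj;
  rewrite !permM ![in LHS]permE ![in RHS]permE /= //.
by rewrite /rot_pair /= invgM -!mulgA mulKg.
Qed.

Definition cm_equiv (gT1 gT2 : finGroupType)
    (M1 : cayley_map gT1) (M2 : cayley_map gT2) : Prop :=
  exists phi : {morphism [set: gT1] >-> gT2},
    [/\ isom [set: gT1] [set: gT2] phi,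
        phi @: cm_set M1 = cm_set M2
      & {in cm_set M1, forall x, phi (cm_perm M1 x) = cm_perm M2 (phi x)}].

(* Generators of D_n (of order 2n, hence 'D_(n.*2)) satisfying the relations of
   the presentation < a, b | a^n = b^2 = baba = 1 >. *)
Definition dihedral_generators (n : nat) (a b : 'D_(n.*2)) : Prop :=
  [/\ a ^+ n = 1, b ^+ 2 = 1, b * a * b * a = 1
    & <<[set a; b]>> = [set: 'D_(n.*2)]].

Lemma dihedral_generators_exist (n : nat) : 1 < n ->
  exists a b : 'D_(n.*2), dihedral_generators a b.
Proof.
move=> n_gt1.
have /existsP[[a b] /=] : 'D_(n.*2) \homg Grp (x : y : x ^+ n, y ^+ 2, x ^ y = x^-1).
  by rewrite -(Grp_dihedral n_gt1) homg_refl.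
rewrite !xpair_eqE -?andbA /= => /and4P[/eqP def_G /eqP an /eqP b2 /eqP ab].
exists a, b; split=> //; last by rewrite -def_G joing_idl joing_idr.
have bV : b^-1 = b by apply/(mulgI b); rewrite mulgV -expg2.
by move: ab; rewrite conjgE bV mulgA => ->; rewrite mulVg.
Qed.

(* Main.v *)
(* Write D = L(D_n), B for the cyclic stabiliser of the vertex 1 in G = Aut(M), f for
   its generator that rotates X, and t for the left translation by a reflection in X.
   Then G = B D = <f, t>, and G acts on the left cosets of D, a set on which B is
   regular and on which t acts as x |-> x^-1 acts on X. If c and c^g lie in the cyclic
   group C, then g normalises <c>; as C is core-free, C and C^g meet trivially as soon
   as D and g generate G, so C has orbits of length n or n/2 on such cosets g D.
   - An orbit of length n forces t to fix all cosets outside it, hence X to contain all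
     but at most one of the non-trivial rotations; counting the triangles of the Cayley
     graph through an edge then gives a contradiction.
   - Otherwise the involution z of C is conjugated to a reflection of D by every such g.
     Comparing the conjugates of z by powers of f shows that the group L generated by D
     and f^2 has index 2 and is the direct product of two dihedral groups W and W^f of
     order n, with n/2 odd and W in D; so f^2 = al * al^f for a rotation al in W, and
     this determines the rotation of X. *)
Require Import Defs.
From mathcomp Require Import all_boot all_order all_fingroup all_solvable.
From mathcomp Require Import zify.

Set Implicit Arguments.
Unset Strict Implicit.
Unset Printing Implicit Defensive.

Import GroupScope.

(** * Groups that are products of a cyclic group and a group of dihedral type *)

Section CyclicDihedralFactorization.

Variables (gT : finGroupType) (G D C : {group gT}) (f t : gT).
Local Notation B := <[f]>.
Local Notation n := #|C|.

Hypothesis defG : B * D = G.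
Hypothesis tiBD : B :&: D = 1.
Hypothesis sCD : C \subset D.
Hypothesis cycC : cyclic C.
Hypothesis C_ge5 : 5 <= n.
Hypothesis cardD : #|D| = n.*2.
Hypothesis invol : {in D :\: C, forall d, d ^+ 2 = 1}.
Hypothesis Dt : t \in D :\: C.
Hypothesis genG : <<[set f; t]>> = G.
Hypothesis tiBt : B :&: B :^ t = 1.
Hypothesis coreC : forall E : {group gT}, E \subset C -> f \in 'N(E) -> E :=: 1.

Lemma sDG : D \subset G. Proof. by rewrite -defG mulG_subr. Qed.
Lemma sBG : B \subset G. Proof. by rewrite -defG mulG_subl. Qed.
Lemma Gf : f \in G. Proof. by rewrite (subsetP sBG) ?cycle_id. Qed.

Lemma indexCD : #|D : C| = 2.
Proof. by rewrite -divgS // cardD -muln2 mulKn //; lia. Qed.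

Lemma nCD : C <| D. Proof. by rewrite index2_normal ?indexCD. Qed.

Lemma invV d : d \in D :\: C -> d^-1 = d.
Proof. by move=> Dd; apply/eqP; rewrite eq_invg_mul -expg2 invol. Qed.

Lemma mulDC' d c : d \in D :\: C -> c \in C -> d * c \in D :\: C.
Proof.
case/setDP=> Dd nCd Cc; rewrite inE groupMr // nCd groupM //.
exact: (subsetP sCD).
Qed.

(** Counting shows that the coset [d *: C] is all of [D :\: C], and [d] is its own inverse. *)
Lemma mulDC d e : d \in D :\: C -> e \in D :\: C -> d * e \in C.
Proof.
move=> Dd De; have /eqP defDC: d *: C == D :\: C.
  rewrite eqEcard card_lcoset cardsD (setIidPr sCD) cardD -addnn addnK leqnn andbT.
  by apply/subsetP=> _ /lcosetP[c Cc ->]; apply: mulDC'.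
by rewrite -(invV Dd) -mem_lcoset defDC.
Qed.

Lemma mulCD' d c : d \in D :\: C -> c \in C -> c * d \in D :\: C.
Proof.
case/setDP=> Dd nCd Cc; rewrite inE groupMl // nCd groupM //.
exact: (subsetP sCD).
Qed.

Lemma conjCD d c : d \in D :\: C -> c \in C -> c ^ d = c^-1.
Proof.
move=> Dd Cc; have := invV (mulDC' Dd Cc); rewrite invMg (invV Dd) => e.
by rewrite conjgE (invV Dd) mulgA -e -mulgA -expg2 invol ?mulg1.
Qed.

Lemma conjDC d c : d \in D :\: C -> c \in C -> d ^ c = d * c ^+ 2.
Proof.
move=> Dd Cc; have := conjCD Dd (groupVr Cc); rewrite invgK => e.
by rewrite conjgE mulgA (conjgC c^-1) e expg2 mulgA.
Qed.

Lemma nCsubD (E : {group gT}) : E \subset C -> D \subset 'N(E).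
Proof.
move=> sEC; apply: normal_norm; apply: char_normal_trans nCD.
by rewrite sub_cyclic_char.
Qed.

Lemma norm_subC (E : {group gT}) g :
  E \subset C -> E :^ g \subset C -> g \in 'N(E).
Proof.
move=> sEC sEgC; rewrite inE.
have /eqP -> : E :^ g == E by rewrite (eq_subG_cyclic cycC) //= cardJg.
by [].
Qed.

(** These are the elements to which core-freeness applies: [D] normalises every subgroup of [C], so
    one that such an element normalises too is normalised by [f], hence trivial. *)
Definition gener : {set gT} := [set g in G | D <*> <[g]> == G].

Lemma generG g : g \in gener -> g \in G. Proof. by case/setIdP. Qed.

Lemma generP g (H : {group gT}) :
  g \in gener -> D \subset H -> g \in H -> G \subset H.
Proof.
by case/setIdP=> _ /eqP <- sDH Hg; rewrite join_subG sDH cycle_subG.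
Qed.

Lemma generI g : g \in G ->
  (forall H : {group gT}, D \subset H -> H \subset G -> g \in H -> G \subset H) ->
  g \in gener.
Proof.
move=> Gg genH; rewrite inE Gg eqEsubset join_subG sDG cycle_subG Gg /=.
apply: genH; rewrite ?joing_subl ?join_subG ?sDG ?cycle_subG //.
by rewrite mem_gen // inE cycle_id orbT.
Qed.

Lemma gener_f : f \in gener.
Proof.
apply: generI Gf _ => H sDH sHG Hf; rewrite -defG mul_subG ?cycle_subG //.
Qed.

Lemma generV g : g \in gener -> g^-1 \in gener.
Proof.
move=> gg; apply: generI => [|H sDH sHG Hg]; first by rewrite groupV generG.
by apply: (generP gg sDH); rewrite -groupV.
Qed.

Lemma generMl d g : d \in D -> (d * g \in gener) = (g \in gener).
Proof.
move=> Dd; have main e h : e \in D -> h \in gener -> e * h \in gener.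
  move=> De gh; apply: generI => [|H sDH sHG Heh].
    by rewrite groupM ?(subsetP sDG _ De) // generG.
  by apply: (generP gh sDH); rewrite -(groupMl _ (subsetP sDH _ De)).
by apply/idP/idP => gg; [rewrite -(mulKg d g) main ?groupV | rewrite main].
Qed.

Lemma generMr d g : d \in D -> (g * d \in gener) = (g \in gener).
Proof.
move=> Dd; have inv h : (h \in gener) = (h^-1 \in gener).
  by apply/idP/idP=> /generV; rewrite ?invgK.
by rewrite inv invMg generMl ?groupV // -inv.
Qed.

(* The subgroup generated by c is normalised by g, because C is cyclic, and by D. *)
Lemma gener_conj g c : g \in gener -> c \in C -> c ^ g \in C -> c = 1.
Proof.
move=> gg Cc Ccg; pose E := <[c]>%G.
have sEC: E \subset C by rewrite cycle_subG.
have nEg: g \in 'N(E) by apply: norm_subC => //; rewrite -cycleJ cycle_subG.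
have: E :=: 1 by apply: coreC => //; apply: (subsetP (generP gg (nCsubD sEC) nEg)); apply: Gf.
by move/eqP; rewrite cycle_eq1 => /eqP.
Qed.

(** * The connection set and the action on the left cosets of [D] *)

Lemma cardG : #|G| = (#|B| * n.*2)%N.
Proof. by rewrite -defG TI_cardMg ?cardD. Qed.

(* When t is the left translation by x in the connection set X, f the rotation
   at the vertex 1 and b = f ^+ i, [tr b] is the left translation by the i-th
   element after x in the cyclic order of X; [connset] below is thus X. *)
Definition tr b := remgr B D (t * b).

Lemma tG : t \in G. Proof. by case/setDP: Dt => /(subsetP sDG). Qed.
Lemma t2 : t * t = 1. Proof. by rewrite -expg2 invol. Qed.

Lemma trP b : b \in B -> exists2 u, u \in B & t * b = u * tr b.
Proof.
move=> Bb; exists (divgr B D (t * b)); last exact: divgr_eq.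
by rewrite mem_divgr // defG groupM ?tG // (subsetP sBG).
Qed.

Lemma trE b u x : u \in B -> x \in D -> t * b = u * x -> tr b = x.
Proof. by move=> Bu Dx e; rewrite /tr e remgrMid. Qed.

Lemma trD b : b \in B -> tr b \in D.
Proof.
by move=> Bb; rewrite mem_remgr // defG groupM ?tG // (subsetP sBG).
Qed.

Lemma tr_neq1 b : b \in B -> tr b != 1.
Proof.
move=> Bb; have [u Bu e] := trP Bb; apply/eqP=> x1; move: e; rewrite x1 mulg1.
move/(canRL (mulgK _)) => te; have: t \in B :&: D.
  by rewrite inE; case/setDP: Dt => -> _; rewrite te groupM ?groupV.
by rewrite tiBD => /set1gP e1; case/setDP: Dt => _ /negP[]; rewrite e1 group1.
Qed.

(** If [tr b = tr c], then [b * c^-1] lies in both [B] and [B :^ t]; on the map, it fixes both ends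
    of an arc. *)
Lemma tr_inj : {in B &, injective tr}.
Proof.
move=> b c Bb Bc e; have [u Bu eb] := trP Bb; have [v Bv ec] := trP Bc.
have: b * c^-1 \in B :&: B :^ t.
  rewrite inE groupM ?groupV //= mem_conjg conjgE invgK mulgA.
  have -> : t * (b * c^-1) * t^-1 = (t * b) * (t * c)^-1 by rewrite invMg !mulgA.
  by rewrite eb ec e invMg mulgA mulgK groupM ?groupV.
by rewrite tiBt => /set1gP/eqP; rewrite -eq_mulgV1 => /eqP.
Qed.

(** As [t] is an involution, [t * b = u * x] can be solved as [t * u = b * x^-1]. So [t] sends the
    coset of [b] to that of [u], which acts as inversion on the connection set. *)
Lemma tr_inv b : b \in B -> exists2 u, u \in B & tr u = (tr b)^-1.
Proof.
move=> Bb; have [u Bu e] := trP Bb; exists u => //.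
apply: (trE Bb); first by rewrite groupV trD.
by rewrite -[u](mulgK (tr b)) -e !mulgA t2 mul1g.
Qed.

(** The left side says that [t] fixes the coset [b *: D]. Since [t] acts as inversion, its fixed
    points are the elements of X that square to 1. *)
Lemma tr_fix b : b \in B -> (t ^ b \in D) = (tr b ^+ 2 == 1).
Proof.
move=> Bb; have [u Bu e] := trP Bb; apply/idP/eqP=> [Dtb | x2].
  suff -> : tr b = t ^ b by rewrite -conjXg invol ?conj1g.
  by apply: (trE Bb) => //; rewrite conjgE mulKVg.
have [v Bv ev] := tr_inv Bb.
have xV: (tr b)^-1 = tr b by apply/eqP; rewrite eq_invg_mul -expg2 x2.
have e2: t * u = b * tr b.
  by rewrite -[in RHS]xV -[u](mulgK (tr b)) -e !mulgA t2 mul1g.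
have eub: u = b by apply: tr_inj => //; apply: (trE Bb) => //; apply: trD.
by rewrite conjgE e eub mulKg trD.
Qed.

Lemma tr_fixE b : b \in B -> t ^ b \in D -> tr b = t ^ b.
Proof. by move=> Bb Dtb; apply: (trE Bb) => //; rewrite conjgE mulKVg. Qed.

(** [B] is a transversal of the left cosets of [D]; these are the cosets fixed by [t]. *)
Definition fixt := [set b in B | t ^ b \in D].
Definition refl := [set b in B | tr b \notin C].

Lemma reflP b : b \in B -> (b \in refl) = (t ^ b \in D :\: C).
Proof.
move=> Bb; rewrite inE Bb /=; apply/idP/setDP=> [nC|[Dtb]].
  have Dx: tr b \in D :\: C by rewrite inE nC trD.
  have Dtb: t ^ b \in D by rewrite tr_fix // invol.
  by rewrite -tr_fixE // trD.
by rewrite tr_fixE.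
Qed.

Lemma refl_sub_fix : refl \subset fixt.
Proof.
apply/subsetP=> b rb; have Bb: b \in B by case/setIdP: rb.
by move: rb; rewrite reflP // [b \in fixt]inE Bb => /setDP[].
Qed.

Lemma refl1 : 1 \in refl.
Proof. by rewrite reflP ?group1 // conjg1. Qed.

(** The product [t ^ b * t ^ c] of two reflections is a rotation, and so is its conjugate by [g];
    [gener_conj] makes it trivial. *)
Lemma refl_gener_inj (b c g : gT) : b \in refl -> c \in refl ->
  b * g \in refl -> c * g \in refl -> g \in B -> g \in gener -> b = c.
Proof.
move=> rb rc rbg rcg Bg gg.
have [Bb Bc]: b \in B /\ c \in B by case/setIdP: rb; case/setIdP: rc.
move: rb rc rbg rcg; rewrite !reflP ?groupM // => Db Dc Dbg Dcg.
have e: t ^ b * t ^ c = 1.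
  apply: (gener_conj gg); first exact: mulDC.
  by rewrite conjMg -!conjgM; apply: mulDC.
have [[Dtb _] [Dtc _]] := (setDP Db, setDP Dc).
by apply: tr_inj => //; rewrite !tr_fixE //; apply/eqP; rewrite eq_mulgV1 (invV Dc) e.
Qed.

Lemma card_rot : #|B :\: refl| <= n.-1.
Proof.
have inj: {in B :\: refl &, injective tr}.
  by move=> b c /setDP[Bb _] /setDP[Bc _]; apply: tr_inj.
rewrite -(card_in_imset inj) (cardsD1 1 C) group1 subset_leq_card //.
apply/subsetP=> _ /imsetP[b /setDP[Bb nr] ->]; rewrite in_setD1 tr_neq1 //.
by move: nr; rewrite inE Bb negbK.
Qed.

Lemma cardB_lt : #|B| < n.*2.
Proof.
rewrite -(card_in_imset tr_inj) -cardD (cardsD1 1 D) group1 ltnS subset_leq_card //.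
by apply/subsetP=> _ /imsetP[b Bb ->]; rewrite in_setD1 tr_neq1 // trD.
Qed.

(** * Counting triangles of the Cayley graph *)

Definition connset := tr @: B.
Local Notation X := connset.
Local Notation Q := (X :&: C).
Local Notation F := (X :\: C).

Lemma connsetP d : d \in D -> (d \in X) = (d \in (B :* t) * B).
Proof.
move=> Dd; apply/imsetP/mulsgP=> [[b Bb ->] | [u v /rcosetP[b Bb ->] Bv e]].
  have [u Bu e] := trP Bb; exists (u^-1 * t) b => //.
    by apply/rcosetP; exists u^-1; rewrite ?groupV.
  by rewrite -mulgA e mulKg.
exists v => //; apply/esym; apply: (@trE _ b^-1); rewrite ?groupV //.
by rewrite e -[b * t * v]mulgA mulKg.
Qed.

Lemma card_mulBD (A E : {set gT}) : A \subset B -> E \subset D ->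
  #|A * E| = (#|A| * #|E|)%N.
Proof.
move=> sAB sED; rewrite -cardsX.
rewrite [A * E](_ : _ = (fun p : gT * gT => p.1 * p.2) @: setX A E).
  apply: card_in_imset => -[b d] [c e] /setXP[/= Ab Ed] /setXP[/= Ac Ee] eq.
  have := congr1 (remgr B D) eq.
  rewrite !remgrMid ?(subsetP sAB) ?(subsetP sED) // => de.
  by move: eq; rewrite de => /mulIg ->.
apply/setP=> x; apply/mulsgP/imsetP=> [[b d Bb Ad ->] | [[b d] /setXP[Bb Ad] ->]].
  by exists (b, d); rewrite ?inE ?Bb.
by exists b d.
Qed.

(* Every arc of the Cayley graph lies in the same number of triangles: the
   double coset B t B is the adjacency relation on the cosets of B. *)
Lemma card_triangles (y : gT) : y \in X -> #|X :&: X :* y| = #|X :&: X :* t|.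
Proof.
pose U := (B :* t) * B.
have Ub (b : gT) : b \in B -> U :* b = U.
  by move=> Bb; rewrite /U -(mulgA (B :* t)) (rcoset_id Bb).
have bU (b : gT) : b \in B -> b *: U = U.
  by move=> Bb; rewrite /U !mulgA (lcoset_id Bb).
have sXD: X \subset D by apply/subsetP=> _ /imsetP[b Bb ->]; apply: trD.
have main x : x \in X -> #|U :&: U :* x| = (#|B| * #|X :&: X :* x|)%N.
  move=> Xx; have Dx := subsetP sXD _ Xx.
  rewrite -card_mulBD ?subIset ?sXD //; congr #|pred_of_set _|.
  have UM (b g : gT) : b \in B -> (b * g \in U) = (g \in U).
    by move=> Bb; rewrite -{1}(bU b Bb) mem_lcoset mulKg.
  apply/setP=> g; rewrite inE mem_rcoset; apply/andP/mulsgP=> [[Ug Ugx]|].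
    have: g \in B * D.
      rewrite defG; case/mulsgP: Ug => _ v /rcosetP[u Bu ->] Bv ->.
      by rewrite !groupM ?tG // (subsetP sBG).
    case/mulsgP=> b d Bb Dd e; exists b d => //.
    have Ddx: d * x^-1 \in D by rewrite groupM ?groupV.
    rewrite inE mem_rcoset !connsetP //.
    by move: Ug Ugx; rewrite e -mulgA !(UM b _ Bb) => -> ->.
  case=> b d Bb /setIP[Xd]; rewrite mem_rcoset => Xdx ->.
  have Dd := subsetP sXD _ Xd.
  have Ddx: d * x^-1 \in D by rewrite groupM ?groupV.
  by rewrite -mulgA !(UM b _ Bb) -!connsetP.
have Xt: t \in X.
  apply/imsetP; exists 1; rewrite ?group1 //; apply/esym; apply: (@trE _ 1) => //.
    by case/setDP: Dt.
  by rewrite mulg1 mul1g.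
move=> Xy; apply/eqP; rewrite -(eqn_pmul2l (cardG_gt0 <[f]>)) -!main //.
have: y \in U by rewrite -connsetP // (subsetP sXD).
case/mulsgP=> _ v /rcosetP[u Bu ->] Bv ->.
rewrite !rcosetM Ub // -{1}(Ub v Bv) -(card_rcoset (U :&: U :* t) v).
by apply/eqP/eq_card=> g; rewrite [in RHS]mem_rcoset !in_setI !mem_rcoset.
Qed.

Lemma connset_sub : X \subset D.
Proof. by apply/subsetP=> _ /imsetP[b Bb ->]; apply: trD. Qed.

Lemma card_connD : #|F| = #|refl|.
Proof.
have -> : F = tr @: refl.
  apply/setP=> x; apply/setDP/imsetP=> [[/imsetP[b Bb ->] nC] | [b]].
    by exists b; rewrite // inE Bb.
  by case/setIdP=> Bb nC ->; rewrite nC imset_f.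
by apply: card_in_imset => b c /setIdP[Bb _] /setIdP[Bc _]; apply: tr_inj.
Qed.

Lemma card_condE (A : {set gT}) (P : pred gT) :
  #|[set x in A | P x]| = (\sum_(x in A) P x)%N.
Proof. by rewrite -sum1dep_card big_mkcondr; apply: eq_bigr => x _; case: (P x). Qed.

Lemma connset_t : t \in F.
Proof.
case/setDP: (Dt) => tD nCt; rewrite inE nCt /=; apply/imsetP; exists 1; rewrite ?group1 //.
by apply/esym; apply: (@trE _ 1); rewrite // mulg1 mul1g.
Qed.

(** Each arc lies in [w.*2] triangles, where [w] counts those on the arc of [t] whose third vertex
    is a rotation. Summing over the rotation arcs and double counting the triangles with two
    reflection arcs gives the equation. *)
Lemma triangle_count : exists2 w, w < #|F| &
  (\sum_(y in Q) #|Q :&: Q :* y| + #|F| * w = #|Q| * w.*2)%N.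
Proof.
have sXD := subsetP connset_sub.
have FD x : x \in F -> x \in D :\: C by case/setDP=> /sXD Dx nC; rewrite inE nC.
(* Right multiplication by the reflection [b] exchanges the third vertices that are rotations with
   those that are reflections. *)
have twoF b : b \in F -> #|X :&: X :* b| = #|Q :&: F :* b|.*2.
  move=> Fb; have Db := FD _ Fb; have [_ nCb] := setDP Db.
  rewrite -(cardsID C) -addnn; congr (_ + _)%N.
    apply/eq_card=> x; rewrite !inE !mem_rcoset in_setD.
    case Cx: (x \in C); rewrite ?andbF // andbT.
    by rewrite groupMl // groupV nCb andbT.
  rewrite -(card_rcoset _ b); apply/eq_card=> x.
  rewrite mem_rcoset !inE !mem_rcoset (invV Db) -mulgA -expg2 (invol Db) mulg1 in_setD.
  case Xx: (x \in X); rewrite ?andbF //= andbT andbC; case Xxb: (x * b \in X); rewrite ?andbF //.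
  case Cx: (x \in C); first by rewrite groupMl // nCb.
  by rewrite mulDC // inE Cx sXD.
pose w := #|Q :&: F :* t|; have Ft := connset_t.
have wE b : b \in F -> #|Q :&: F :* b| = w.
  move=> Fb; apply: double_inj; rewrite -!twoF //; apply: card_triangles.
  by case/setDP: Fb.
exists w.
  rewrite -(card_rcoset F t) (cardsD1 1 (F :* t)) mem_rcoset mul1g.
  have -> : t^-1 \in F by rewrite (invV Dt).
  rewrite ltnS subset_leq_card //; apply/subsetP=> x /setIP[/setIP[Xx _] Fx].
  rewrite in_setD1 Fx andbT; apply: contraTneq Xx => ->.
  by apply/imsetP=> -[b Bb /esym/eqP]; apply/negP/tr_neq1.
have -> : (#|Q| * w.*2 = \sum_(y in Q) (#|Q :&: Q :* y| + #|F :&: F :* y|))%N.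
  rewrite -sum_nat_const; apply: eq_bigr => y /setIP[Xy Cy].
  have -> : w.*2 = #|X :&: X :* y| by rewrite card_triangles // twoF.
  rewrite -(cardsID C); congr (_ + _)%N; apply/eq_card=> x.
    rewrite !inE !mem_rcoset !inE; case Cx: (x \in C); rewrite ?andbF // andbT.
    by rewrite groupMl // groupV Cy !andbT.
  rewrite !inE !mem_rcoset !inE; case Cx: (x \in C) => //=.
  by rewrite groupMr ?groupV // Cx.
rewrite big_split /=; congr (_ + _)%N.
have -> : (\sum_(y in Q) #|F :&: F :* y| = \sum_(y in Q) \sum_(x in F) (x \in F :* y))%N.
  by apply: eq_bigr => y _; rewrite -card_condE; apply/eq_card=> x; rewrite !inE.
rewrite exchange_big -sum_nat_const /=; apply: eq_bigr => x Fx.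
have swap y : y \in Q -> (x \in F :* y) = (y \in F :* x).
  case/setIP=> _ Cy; have Dx := FD _ Fx.
  by rewrite !mem_rcoset (invV Dx) (conjgC y) (conjCD Dx Cy).
rewrite -(wE x Fx) -card_condE; apply/eq_card=> y.
by apply/setIP/setIdP=> -[Qy]; rewrite swap.
Qed.

(** One form in which the bound on [n] is used: conjugation by [c] multiplies a reflection by
    [c ^+ 2], which must not square to 1. *)
Lemma C_generator : exists2 c, C :=: <[c]> & c ^+ 4 != 1.
Proof.
have [c defC] := cyclicP cycC; exists c => //; rewrite -order_dvdn orderE -defC.
by apply/negP=> /dvdn_leq => /(_ isT); rewrite leqNgt C_ge5.
Qed.

(** * Orbits of [C] on the left cosets of [D] *)

Lemma defGr : D * B = G.
Proof. by rewrite -(invGid G) -defG invMg !invGid. Qed.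

(** The representatives in [B] of the cosets in the [C]-orbit of [b *: D]. *)
Definition orb b := B :&: C * (b *: D).

Lemma orbP b u : reflect (u \in B /\ exists c d, [/\ c \in C, d \in D & u = c * b * d])
                         (u \in orb b).
Proof.
apply: (iffP setIP) => -[Bu].
  case/mulsgP=> c _ Cc /lcosetP[d Dd ->] e; split=> //.
  by exists c, d; rewrite e mulgA.
case=> c [d [Cc Dd e]]; split=> //; apply/mulsgP; exists c (b * d) => //.
  by apply/lcosetP; exists d.
by rewrite mulgA.
Qed.

(** Orbit-stabiliser: [C :&: D :^ b^-1] is the stabiliser of [b *: D] in [C]. *)
Lemma card_orb b : b \in B -> (#|orb b| * #|C :&: D :^ b^-1| = n)%N.
Proof.
move=> Bb; have e1: C * (b *: D) = orb b * D.
  apply/setP=> x; apply/mulsgP/mulsgP=> [[c _ Cc /lcosetP[d Dd ->] ->] | [u d]].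
    have: c * (b * d) \in B * D.
      by rewrite defG !groupM ?(subsetP sBG b) ?(subsetP sDG) // (subsetP sCD).
    case/mulsgP=> u e Bu De eq; exists u e => //; apply/orbP; split=> //.
    by exists c, (d * e^-1); rewrite groupM ?groupV // mulgA -(mulgA c) eq mulgK.
  case/orbP=> Bu [c [e [Cc De ->]]] Dd ->.
  by exists c (b * (e * d)); rewrite ?mulgA // mem_lcoset -!mulgA mulKg groupM.
have e2: C * (b *: D) = (C * (D :^ b^-1)) :* b.
  by rewrite -mulgA conjsgE invgK -!mulgA mulg_set1 mulVg mulg1.
have := card_mulBD (subsetIl B (C * (b *: D))) (subxx D).
rewrite -/(orb b) -e1 e2 card_rcoset => e3.
have := mul_cardG C (D :^ b^-1)%G; rewrite /= e3 cardJg mulnAC.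
by move/eqP; rewrite eqn_pmul2r // => /eqP.
Qed.

Lemma orb_gener b : b \in gener -> orb b \subset gener.
Proof.
move=> gb; apply/subsetP=> _ /orbP[_ [c [d [Cc Dd ->]]]].
by rewrite generMr // generMl // (subsetP sCD).
Qed.

Lemma sqrt1_uniq c d : c \in C -> d \in C -> c ^+ 2 = 1 -> d ^+ 2 = 1 ->
  c != 1 -> d != 1 -> c = d.
Proof.
move=> Cc Cd c2 d2 nc1 nd1; have oc := nt_prime_order (isT : prime 2) c2 nc1.
have od := nt_prime_order (isT : prime 2) d2 nd1.
have /eqP e: <[c]> :==: <[d]>.
  by rewrite (eq_subG_cyclic cycC) ?cycle_subG // -!orderE oc od.
have: c \in <[d]> by rewrite -e cycle_id.
by rewrite cycle2g // !inE (negbTE nc1) => /eqP.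
Qed.

(** * The case of orbits of length [n / 2] *)

(* z is the involution of C; it generates the stabiliser in C of every left coset
   g D with g in gener. *)
Section NoRegularOrbit.

Variable z : gT.
Hypothesis Cz : z \in C.
Hypothesis z_neq1 : z != 1.
Hypothesis z_sq : z ^+ 2 = 1.
Hypothesis z_gener : {in gener, forall g, z ^ g \in D :\: C}.

Lemma zV : z^-1 = z.
Proof. by apply/eqP; rewrite eq_invg_mul -expg2 z_sq. Qed.

Lemma z_uniq c : c \in C -> c ^+ 2 = 1 -> c != 1 -> c = z.
Proof. by move=> Cc c2 nc1; apply: sqrt1_uniq. Qed.

Lemma z_cent d : d \in D -> z ^ d = z.
Proof.
move=> Dd; case Cd: (d \in C); last by rewrite conjCD ?zV // inE Cd.
by apply/conjg_fixP/commgP/(centsP (cyclic_abelian cycC)).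
Qed.

(** Otherwise [y1 = z ^ f] and [y2 = z ^ (f ^+ 2)] are commuting reflections with product [z], and
    [f] permutes [z], [y1], [y2] cyclically. This leaves too few conjugates of [z]. *)
Lemma gener_sq : f ^+ 2 \notin gener.
Proof.
apply/negP=> g2; have Dy1 := z_gener gener_f; have Dy2 := z_gener g2.
set y1 := z ^ f in Dy1; set y2 := z ^ (f ^+ 2) in Dy2.
have y2E: y2 = y1 ^ f by rewrite /y2 expg2 conjgM.
have [Dy1' nCy1] := setDP Dy1; have [Dy2' nCy2] := setDP Dy2.
have com: y1 ^ y2 = y1 by rewrite y2E -conjJg z_cent.
have c12: y1 * y2 = z.
  apply: z_uniq; first exact: mulDC.
    move: com; rewrite conjgE (invV Dy2) => com.
    by rewrite expg2 -mulgA com -expg2 invol.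
  apply: contraNneq nCy1 => /(canRL (mulgK _)); rewrite mul1g (invV Dy2) y2E.
  by move/conjg_inj=> <-.
have y2E': y2 = y1 * z by rewrite -c12 mulgA -expg2 invol ?mul1g.
have z3: z ^ (f ^+ 3) = z.
  rewrite (expgSr f 2) conjgM -/y2 y2E' conjMg -y2E -/y1 y2E' -mulgA (conjgC z).
  by rewrite z_cent // mulgA -expg2 invol ?mul1g.
have [c defC /eqP[]] := C_generator; have Cc: c \in C by rewrite defC cycle_id.
have Gfc: f * c \in D * B.
  by rewrite defGr groupM ?Gf // (subsetP sDG) // (subsetP sCD).
have gfc: f * c \in gener by rewrite generMr ?gener_f // (subsetP sCD).
(* As [G = D * B] and [D] centralises [z], the only conjugates of [z] are [z], [y1] and [y2]. But
   [z ^ (f * c) = y1 * c ^+ 2], so [c ^+ 2] is 1 or [z]. *)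
have: z ^ (f * c) \in [set y1; y2].
  move: (z_gener gfc); have /mulsgP[d _ Dd /cycleP[i ->] ->] := Gfc.
  rewrite conjgM z_cent // (divn_eq i 3) expgD mulnC expgM conjgM.
  have -> : z ^ (f ^+ 3) ^+ (i %/ 3) = z by elim: (i %/ 3) => [|q IH]; rewrite ?conjg1 // expgS conjgM z3.
  have := ltn_pmod i (isT : 0 < 3); case: (i %% 3) => [|[|[|]]] // _.
  - by rewrite conjg1 inE Cz.
  - by rewrite expg1 !inE eqxx.
  by rewrite !inE eqxx orbT.
rewrite conjgM -/y1 conjDC // !inE -{2}[y1]mulg1 y2E' !(inj_eq (mulgI _)).
by rewrite -[4]/(2 * 2)%N expgM => /orP[] /eqP ->; rewrite ?expg1n.
Qed.

Definition evenG : {group gT} := (D <*> <[f ^+ 2]>)%G.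
Local Notation L := evenG.

Lemma sDL : D \subset L. Proof. exact: joing_subl. Qed.
Lemma Lf2 : f ^+ 2 \in L. Proof. by rewrite mem_gen // inE cycle_id orbT. Qed.
Lemma sLG : L \subset G.
Proof. by rewrite join_subG sDG cycle_subG groupX ?Gf. Qed.

Lemma Lf : f \notin L.
Proof.
apply/negP=> Lf; case/negP: gener_sq; rewrite inE groupX ?Gf //= eqEsubset sLG /=.
exact: generP gener_f sDL Lf.
Qed.

Lemma LfX i : (f ^+ i \in L) = ~~ odd i.
Proof.
rewrite -{1}(odd_double_half i) expgD -mul2n expgM groupMr; last by rewrite groupX ?Lf2.
by case: (odd i); rewrite ?expg1 ?(negbTE Lf) // expg0 group1.
Qed.

Lemma even_order : ~~ odd #[f].
Proof. by rewrite -LfX expg_order group1. Qed.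

(** [L] is proper because [f] is not in it, and contains the product of [<[f ^+ 2]>] and [D], which
    has half the order of [G]. *)
Lemma card_evenG : (#|L|.*2 = #|G|)%N.
Proof.
have ev: 2 %| #[f] by rewrite dvdn2 even_order.
have Llt: #|L| < #|G|.
  by rewrite proper_card // properE sLG; apply/negP=> /subsetP/(_ f Gf); apply/negP/Lf.
have sM: <[f ^+ 2]> * D \subset L by rewrite mul_subG ?sDL // cycle_subG Lf2.
have := subset_leq_card sM; rewrite TI_cardMg; last first.
  by apply/trivgP; rewrite -tiBD setSI // cycleX.
rewrite -orderE orderXdiv // cardD; have := cardSg sLG; move: Llt; rewrite cardG.
rewrite -[#|B|]/#[f]; case/dvdnP: ev => h ->; rewrite mulnK // mulnAC.
move: (h * _)%N #|L| => N l h1 /dvdnP[q e] h2.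
by move: h1 e; case: q => [|[|[|q]]]; lia.
Qed.

Lemma gener_notL g : g \in gener -> g \notin L.
Proof.
by move=> gg; apply: contra Lf => Lg; apply: (subsetP (generP gg sDL Lg)) Gf.
Qed.

Lemma card_orb_gener b : b \in B -> b \in gener -> (#|orb b|.*2 = n)%N.
Proof.
move=> Bb gb; rewrite -muln2 -(card_orb Bb); congr (_ * _)%N.
rewrite -(nt_prime_order (isT : prime 2) z_sq z_neq1) orderE cycle2g; last first.
  exact: nt_prime_order z_sq z_neq1.
apply: eq_card => c; rewrite !inE mem_conjgV.
apply/idP/idP=> [/orP[]/eqP-> | /andP[Cc Dcb]]; rewrite ?group1 ?conj1g ?group1 ?Cz //.
  by case/setDP: (z_gener gb).
have [//|nc1] := eqVneq c 1; apply/eqP/z_uniq => //.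
have Dcb': c ^ b \in D :\: C.
  by rewrite inE Dcb andbT; apply: contra nc1 => Ccb; apply/eqP/(gener_conj gb).
by apply: (conjg_inj b); rewrite conjXg invol ?conj1g.
Qed.

(* Otherwise G acts on the 3 cosets of the group generated by D and f ^+ 3, and t
   fixes so few cosets of D that X has more than n - 1 elements in C. *)
Lemma gener_cube : f ^+ 3 \in gener.
Proof.
apply: contraT => ng3; pose H := (D <*> <[f ^+ 3]>)%G.
have sDH: D \subset H by apply: joing_subl.
have Hf3: f ^+ 3 \in H by rewrite mem_gen // inE cycle_id orbT.
have sHG: H \subset G by rewrite join_subG sDG cycle_subG groupX ?Gf.
have Hf: f \notin H.
  apply: contra ng3 => Hf; rewrite inE groupX ?Gf //= eqEsubset sHG /=.
  exact: generP gener_f sDH Hf.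
have HfX i : (f ^+ i \in H) = (3 %| i).
  rewrite /dvdn {1}(divn_eq i 3) mulnC expgD expgM groupMl; last exact: groupX.
  have := ltn_pmod i (isT : 0 < 3); case: (i %% 3) => [|[|[|]]] // _.
  - by rewrite expg0 group1.
  - by rewrite expg1 (negbTE Hf).
  apply/negP=> Hf2; case/negP: Hf; rewrite -(groupMl _ Hf2) -expgSr //.
have k3: 3 %| #[f] by rewrite -HfX expg_order group1.
have k2: 2 %| #[f] by rewrite dvdn2 even_order.
have BH: B :&: H = <[f ^+ 3]>.
  apply/eqP; rewrite eqEsubset subsetI cycleX cycle_subG Hf3 !andbT.
  apply/subsetP=> _ /setIP[/cycleP[i ->]]; rewrite HfX => /dvdnP[q ->].
  by rewrite mulnC expgM mem_cycle.
have BL: B :&: L = <[f ^+ 2]>.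
  apply/eqP; rewrite eqEsubset subsetI cycleX cycle_subG Lf2 !andbT.
  apply/subsetP=> _ /setIP[/cycleP[i ->]]; rewrite LfX -dvdn2 => /dvdnP[q ->].
  by rewrite mulnC expgM mem_cycle.
have BLH: (B :&: L) :&: (B :&: H) \subset <[f ^+ 6]>.
  apply/subsetP=> _ /setIP[/setIP[/cycleP[i ->]]]; rewrite LfX -dvdn2 => i2 /setIP[_].
  rewrite HfX => i3; have /dvdnP[q ->]: 6 %| i by rewrite (@Gauss_dvd 2 3) ?i2.
  by rewrite mulnC expgM mem_cycle.
have k6: 6 %| #[f] by rewrite (@Gauss_dvd 2 3) ?k2.
case/dvdnP: (k6) => h kE.
(* Elements of [gener] avoid both [L] and [H], which leaves [6h - 3h - 2h + h] elements of [B]. *)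
have cardgen: #|B :&: gener| <= (h * 2)%N.
  have sub: B :&: gener \subset B :\: ((B :&: L) :|: (B :&: H)).
    apply/subsetP=> g /setIP[Bg gg]; rewrite !inE Bg (negbTE (gener_notL gg)) andbT /=.
    by apply: contra Hf => Hg; apply: (subsetP (generP gg sDH Hg)) Gf.
  apply: leq_trans (subset_leq_card sub) _.
  have cL: #|B :&: L| = (h * 3)%N.
    by rewrite BL -[LHS]/#[_] orderXdiv // kE -[6]/(3 * 2)%N mulnA mulnK.
  have cH: #|B :&: H| = (h * 2)%N.
    by rewrite BH -[LHS]/#[_] orderXdiv // kE -[6]/(2 * 3)%N mulnA mulnK.
  have c6: #|<[f ^+ 6]>| = h by rewrite -[LHS]/#[_] orderXdiv // kE mulnK.
  have ar (x y q : nat) : (x + y = q * 3 + q * 2)%N -> y <= q -> (q * 6 - x <= q * 2)%N.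
    by clear; lia.
  have sU: (B :&: L) :|: (B :&: H) \subset B by rewrite subUset !subsetIl.
  rewrite cardsD (setIidPr sU) -[#|B|]/#[f] kE.
  have := subset_leq_card BLH; rewrite c6.
  have := cardsUI (B :&: L) (B :&: H); rewrite cL cH.
  by move=> e1 e2; apply: (ar _ _ _ e1 e2).
have kB: #|B| = (h * 6)%N by rewrite -kE.
have gf := gener_f; have Bf : f \in B := cycle_id f.
have orbB b : b \in gener -> orb b \subset B :&: gener.
  by move=> gb; rewrite subsetI subsetIl orb_gener.
(* Two disjoint orbits of length [n / 2] would put [n] elements into a set of size at most
   [#|B| / 3], while [#|B| < 2n]. *)
have fV: f^-1 \in orb f.
  apply: contraT => nfV; have gV := generV gf.
  have dis: [disjoint orb f & orb f^-1].
    apply/pred0P=> u /=; apply/negP=> /andP[/orbP[Bu [c [d [Cc Dd ->]]]]].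
    case/orbP=> _ [c' [d' [Cc' Dd' e]]]; case/negP: nfV; apply/orbP.
    rewrite groupV Bf; split=> //; exists (c'^-1 * c), (d * d'^-1).
    rewrite !groupM ?groupV //; split=> //.
    have -> : c'^-1 * c * f * (d * d'^-1) = c'^-1 * (c * f * d) * d'^-1 by rewrite !mulgA.
    by rewrite e -!mulgA mulKg mulgV mulg1.
  have: #|orb f :|: orb f^-1| <= #|B :&: gener|.
    by rewrite subset_leq_card // subUset !orbB.
  rewrite cardsU (eqP (_ : #|orb f :&: orb f^-1| == 0)); last by rewrite cards_eq0 setI_eq0.
  have := card_orb_gener Bf gf; have := card_orb_gener (groupVr Bf) gV.
  have := cardB_lt; move: cardgen C_ge5; rewrite kB subn0.
  by move: #|_| #|_| #|_| #|_|; clear; lia.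
(* Writing [f^-1 = c * f * d] gives [f ^- 2 = c ^ f * d], which would lie in [H], although 3 does
   not divide 2. *)
have nHf: f \notin 'N(H).
  apply/negP=> nHf; case/orbP: fV => _ [c [d [Cc Dd]]].
  rewrite (conjgC c) -mulgA => /(canLR (mulKg _)).
  have: c ^ f * d \in H.
    by rewrite groupM ?(subsetP sDH d) // memJ_norm // (subsetP sDH) // (subsetP sCD).
  by move=> + e; rewrite -e -expg2 expgVn groupV HfX.
have tH: t \in H by case/setDP: Dt => /(subsetP sDH).
have HfV i j : (f ^- i * f ^+ j \in H) = (i == j %[mod 3]).
  have hi: f ^+ (2 * i + i) \in H by rewrite HfX -mulSnr dvdn_mulr.
  rewrite -(groupMl _ hi) (expgD _ (2 * i)) -mulgA mulKVg -expgD HfX.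
  by clear; lia.
have fixH: fixt \subset B :&: H.
  apply/subsetP=> g /setIdP[Bg Dtg]; rewrite inE Bg /=; apply: contraR nHf => nHg.
  pose P j := t ^ (f ^+ j) \in H.
  have P3 i j : i = j %[mod 3] -> P i = P j.
    move=> eij; have: f ^- i * f ^+ j \in H by rewrite HfV; apply/eqP.
    by move=> hH; rewrite /P -[f ^+ j](mulKVg (f ^+ i)) conjgM (groupJr _ hH).
  (* Since [t] fixes the coset [H], once it fixes a second of the three cosets of [H] it fixes the
     third. *)
  have P2 j : ~~ (3 %| j) -> P j -> P (2 * j)%N.
    move=> nj Pj; have: t * f ^+ (2 * j) \in B * D by rewrite defG groupM ?tG // groupX ?Gf.
    case/mulsgP=> _ d /cycleP[i ->] Dd e; have Hd := subsetP sDH _ Dd.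
    have: [|| i == 0 %[mod 3], i == j %[mod 3] | i == 2 * j %[mod 3]].
      by move: nj; clear; lia.
    case/or3P=> ei.
    - have: t * f ^+ (2 * j) \in H by rewrite e groupMr // HfX; move: ei; clear; lia.
      by rewrite groupMl // HfX; move: nj; clear; lia.
    - have: f ^- j * (t * f ^+ (2 * j)) \in H.
        by rewrite e mulgA groupMr // HfV eq_sym.
      rewrite mul2n -addnn expgD !mulgA -(mulgA _ t) -conjgE groupMl // HfX.
      by move: nj; clear; lia.
    rewrite /P conjgE e mulgA groupMr // HfV eq_sym //.
  have Pall j : P j.
    have P0: P 0 by rewrite /P conjg1.
    case/cycleP: (Bg) => l gE; have {}nHg: ~~ (3 %| l) by rewrite -HfX -gE.
    have Pl: P l by rewrite /P -gE (subsetP sDH).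
    have P2l := P2 _ nHg Pl.
    have: [|| j == 0 %[mod 3], j == l %[mod 3] | j == 2 * l %[mod 3]].
      by move: nHg; clear; lia.
    by case/or3P=> /eqP/P3 ->.
  (* If [t] fixes all three cosets, its [B]-conjugates generate a subgroup [N] of [H] with
     [G = N * B]. Then [H = N * (B :&: H)] is normalised by [f]. *)
  pose N := <<t ^: B>>%G.
  have sNH: N \subset H.
    by rewrite gen_subG; apply/subsetP=> _ /imsetP[_ /cycleP[j ->] ->]; apply: Pall.
  have nNB: B \subset 'N(N) by rewrite norms_gen // class_norm.
  have sGNB: G \subset N * B.
    rewrite -norm_joinEr // -genG gen_subG subUset !sub1set.
    rewrite mem_gen ?inE ?cycle_id ?orbT //= mem_gen // inE mem_gen //.
    by apply/imsetP; exists 1; rewrite ?group1 ?conjg1.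
  have <- : N * (B :&: H) = H.
    by rewrite group_modl //; apply/setIidPr/(subset_trans sHG).
  apply: (subsetP (normsM _ _)) (cycle_id f) => //.
  by apply: sub_abelian_norm (cycle_abelian f) (subsetIl _ _).
(* Now [#|refl| <= 2h], so at least [4h] elements of X are rotations; but [n / 2 = #|orb f| <= 2h]
   and at most [n - 1] of them can be. *)
have := card_rot; have := subset_leq_card refl_sub_fix.
have := subset_leq_card fixH; rewrite BH -[#|<[f ^+ 3]>|]/#[_] orderXdiv // kE.
rewrite cardsD (setIidPr _); last by apply/subsetP=> b /setIdP[].
rewrite kB -[6]/(2 * 3)%N mulnA mulnK //.
have := card_orb_gener Bf gf; have := subset_leq_card (orbB _ gf).
by move: cardgen C_ge5; move: #|_| #|_| #|_| #|_|; clear; lia.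
Qed.

(** For the rotation [c = z ^ f^-1 * z ^ f], [gener_cube] shows that [f ^+ 2] normalises [<[c]>].
    The products of [z ^ f] with the conjugates of [z] by odd powers of [f] then telescope inside
    [<[c]>]. *)
Lemma odd_conj g : g \in G -> g \notin L -> z ^ g \in D :\: C.
Proof.
move=> Gg; have: g \in D * B by rewrite defGr.
case/mulsgP=> d _ Dd /cycleP[i ->] ->; rewrite conjgM z_cent //.
rewrite (groupMl _ (subsetP sDL _ Dd)) LfX negbK => oi.
pose c := z ^ (f^-1) * z ^ f.
have Dy := z_gener gener_f; have DyV := z_gener (generV gener_f).
have Cc: c \in C by apply: mulDC.
have cf2: c ^ (f ^+ 2) = z ^ f * z ^ (f ^+ 3).
  by rewrite conjMg -!conjgM -expgS expg2 mulKg.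
have nc: f ^+ 2 \in 'N(<[c]>).
  apply: norm_subC; rewrite ?cycle_subG // -cycleJ cycle_subG cf2.
  exact: mulDC (z_gener gener_cube).
have main j : z ^ f * z ^ (f ^+ j.*2.+1) \in <[c]>.
  elim: j => [|j IH]; first by rewrite expg1 -expg2 (invol Dy) group1.
  have -> : z ^ f * z ^ (f ^+ j.+1.*2.+1) =
      c ^ (f ^+ 2) * (z ^ f * z ^ (f ^+ j.*2.+1)) ^ (f ^+ 2).
    rewrite cf2 conjMg -!conjgM -expgS -expgD addn2 -[RHS]mulgA [X in _ = _ * X]mulgA.
    by rewrite -expg2 -conjXg z_sq conj1g mul1g.
  by rewrite groupM // memJ_norm // cycle_id.
have -> : z ^ (f ^+ i) = z ^ f * (z ^ f * z ^ (f ^+ i)).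
  by rewrite mulgA -expg2 (invol Dy) mul1g.
rewrite mulDC' // -(odd_double_half i) oi add1n.
by apply: subsetP (main _); rewrite cycle_subG.
Qed.

Lemma mulfL g : g \in G -> (g * f \in L) = (g \notin L).
Proof.
rewrite -defGr => /mulsgP[d _ Dd /cycleP[i ->] ->]; have Ld := subsetP sDL _ Dd.
by rewrite -mulgA -expgSr !(groupMl _ Ld) !LfX negbK.
Qed.

(** * Two commuting subgroups [W] and [W :^ f] *)

Definition oddW : {group gT} := <<[set z ^ g | g in G :\: L]>>%G.
Definition evenW : {group gT} := <<[set z ^ g | g in L]>>%G.
Local Notation W := oddW.
Local Notation W0 := evenW.

Lemma Wz g : g \in G -> g \notin L -> z ^ g \in W.
Proof. by move=> Gg nLg; apply/mem_gen/imsetP; exists g; rewrite // inE nLg. Qed.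

Lemma sWD : W \subset D.
Proof.
rewrite gen_subG; apply/subsetP=> _ /imsetP[g /setDP[Gg nLg] ->].
by case/setDP: (odd_conj Gg nLg).
Qed.

Lemma sW0L : W0 \subset L.
Proof.
rewrite gen_subG; apply/subsetP=> _ /imsetP[g Lg ->].
by rewrite groupJ // (subsetP sDL) // (subsetP sCD).
Qed.

Lemma conjWf : W :^ f = W0.
Proof.
rewrite /= -genJ; congr <<_>>; apply/setP=> x; apply/imsetP/imsetP.
  case=> _ /imsetP[g /setDP[Gg nLg] ->] ->; exists (g * f); rewrite ?conjgM //.
  by rewrite mulfL.
case=> g Lg ->; exists (z ^ (g * f^-1)); rewrite -?conjgM ?mulgKV //.
apply/imsetP; exists (g * f^-1) => //; have Gg := subsetP sLG _ Lg.
have GfV: g * f^-1 \in G by rewrite groupM ?groupV ?Gf.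
by rewrite inE GfV andbT -mulfL // mulgKV.
Qed.

Lemma nWL : L \subset 'N(W).
Proof.
rewrite norms_gen //; apply/subsetP=> h Lh; rewrite inE.
apply/subsetP=> _ /imsetP[_ /imsetP[g /setDP[Gg nLg] ->] ->].
rewrite -conjgM; apply/imsetP; exists (g * h) => //.
by rewrite inE groupMr // nLg groupM // (subsetP sLG).
Qed.

(** For [h] in [L] and [g] outside, [z ^ (g * h^-1)] lies in [D] and so centralises [z]; conjugate
    this relation by [h]. *)
Lemma cWW0 : W0 \subset 'C(W).
Proof.
rewrite cent_gen gen_subG; apply/subsetP=> _ /imsetP[h Lh ->].
apply/centP=> _ /imsetP[g /setDP[Gg nLg] ->].
have Gh := subsetP sLG _ Lh; have LhV := groupVr Lh.
have := odd_conj (groupM Gg (groupVr Gh)); rewrite groupMr // => /(_ nLg)/setDP[Dy _].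
apply/commgP/conjg_fixP; have := congr1 (conjg^~ h) (z_cent Dy).
by rewrite /= conjJg -(conjgM _ _ h) mulgKV.
Qed.

Lemma conjW0f : W0 :^ f = W.
Proof. by rewrite -conjWf -conjsgM -expg2; apply: (normP (subsetP nWL _ Lf2)). Qed.

Lemma Wsq c : c \in C -> c ^+ 2 \in W.
Proof.
move=> Cc; have Lc: c \in L by rewrite (subsetP sDL) // (subsetP sCD).
have Gc := subsetP sLG _ Lc; have Dy := z_gener gener_f.
have -> : c ^+ 2 = z ^ f * z ^ (f * c).
  by rewrite conjgM (conjDC Dy Cc) mulgA -(expg2 (z ^ f)) (invol Dy) mul1g.
have nLfc: f * c \notin L by rewrite (groupMr _ Lc) Lf.
by apply: groupM; apply: Wz; rewrite ?Lf // ?groupM ?Gf.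
Qed.

(** Otherwise [W0] lies in [W] and is centralised by it, so that both are abelian. But [W] contains
    [c ^+ 2] and the reflection [z ^ f] inverting it. *)
Lemma nWz : z \notin W.
Proof.
apply/negP=> Wz1; have sW0W: W0 \subset W.
  rewrite gen_subG; apply/subsetP=> _ /imsetP[h Lh ->].
  by rewrite memJ_norm // (subsetP nWL).
have abW: abelian W.
  by rewrite -conjW0f abelianJ; apply: subset_trans cWW0 (centS sW0W).
have [c defC /eqP[]] := C_generator; have Cc: c \in C by rewrite defC cycle_id.
have Dy := z_gener gener_f; have Wy: z ^ f \in W by rewrite Wz ?Gf ?Lf.
have := conjCD Dy (groupX 2 Cc); rewrite conjgE -(centsP abW _ Wy _ (Wsq Cc)) mulKg.
by move/eqP; rewrite eq_sym eq_invg_mul -expgD => /eqP.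
Qed.

(** If [n / 2] were even, [z] would be a power of [c ^+ 2], hence in [W] by [Wsq]. *)
Lemma odd_half_n : exists2 m, odd m & n = (2 * m)%N.
Proof.
have /esym nE := card_orb_gener (cycle_id f) gener_f; rewrite -mul2n in nE.
set m := #|orb f| in nE; exists m => //; apply: contraR nWz => evm.
have [c defC _] := C_generator; have Cc: c \in C by rewrite defC cycle_id.
have oc: #[c] = (2 * m)%N by rewrite orderE -defC.
have <- : c ^+ m = z.
  apply: z_uniq; first exact: groupX.
    by rewrite -expgM mulnC -oc expg_order.
  by rewrite -order_dvdn oc; apply/negP=> /dvdn_leq; move: C_ge5; rewrite nE; lia.
by rewrite -(odd_double_half m) (negbTE evm) add0n -mul2n expgM groupX // Wsq.
Qed.

(** * The direct product [L = W * W0] and the rotation of X *)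

Section Structure.

Variables (m : nat) (c : gT).
Hypothesis odd_m : odd m.
Hypothesis nE : n = (2 * m)%N.
Hypothesis defC : C :=: <[c]>.
Hypothesis c4 : c ^+ 4 != 1.

Lemma mem_c : c \in C. Proof. by rewrite defC cycle_id. Qed.

Lemma order_c : #[c] = (2 * m)%N. Proof. by rewrite orderE -defC. Qed.

Lemma m_gt1 : 1 < m. Proof. by move: C_ge5; rewrite nE; lia. Qed.

Lemma order_c2 : #[c ^+ 2] = m.
Proof. by rewrite orderXdiv order_c ?mulKn // dvdn_mulr. Qed.

Lemma expc_m : c ^+ m = z.
Proof.
apply: z_uniq; first by rewrite groupX ?mem_c.
  by rewrite -expgM mulnC -order_c expg_order.
by rewrite -order_dvdn order_c; apply/negP=> /dvdn_leq; have := m_gt1; lia.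
Qed.

Lemma WC : W :&: C = <[c ^+ 2]>.
Proof.
apply/eqP; rewrite eqEsubset; apply/andP; split; last first.
  by rewrite cycle_subG in_setI Wsq ?groupX ?mem_c.
apply/subsetP=> x /setIP[Wx]; rewrite defC => /cycleP[i xE]; rewrite xE in Wx *.
rewrite -(odd_double_half i) in Wx *; move: Wx; rewrite expgD -mul2n expgM.
rewrite groupMr; last by rewrite groupX ?Wsq ?mem_c.
case: (odd i) => [|_]; last first.
  by rewrite expg0 mul1g mem_cycle.
by rewrite expg1 => Wc; case/negP: nWz; rewrite -expc_m groupX.
Qed.

Lemma W_zf : z ^ f \in W. Proof. by rewrite Wz ?Gf ?Lf. Qed.

Lemma card_W : #|W| = n.
Proof.
have Dy := z_gener gener_f; have eD: C * W = D.
  apply/eqP; rewrite eqEsubset mul_subG ?sWD //=; apply/subsetP=> d Dd.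
  case Cd: (d \in C); first by rewrite -[d]mulg1 mem_mulg.
  have -> : d = (d * z ^ f) * z ^ f by rewrite -mulgA -expg2 (invol Dy) mulg1.
  by rewrite mem_mulg ?W_zf // mulDC // inE Cd.
have := mul_cardG C W; rewrite eD cardD setIC WC -[#|<[_]>|]/#[_] order_c2.
rewrite -mul2n -mulnA (mulnCA 2) -nE => /eqP; rewrite eqn_pmul2l // => /eqP //.
Qed.

(** A common element centralises [c ^+ 2] and [z ^ f], both in [W]. The first excludes reflections;
    the second leaves 1 and [z], and [z] is not in [W]. *)
Lemma tiWW0 : W :&: W0 = 1.
Proof.
apply/trivgP/subsetP=> x /setIP[Wx /(subsetP cWW0)/centP cx]; apply/set1gP.
have Dx := subsetP sWD _ Wx; case Cx: (x \in C); last first.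
  have xD: x \in D :\: C by rewrite inE Cx.
  have := conjCD xD (groupX 2 mem_c); rewrite conjgE -(cx _ (Wsq mem_c)) mulKg.
  by move/eqP; rewrite eq_sym eq_invg_mul -expgD (negbTE c4).
have := conjCD (z_gener gener_f) Cx; rewrite conjgE (cx _ W_zf) mulKg.
move/eqP; rewrite eq_sym eq_invg_mul -expg2 => /eqP x2.
apply: contraNeq nWz => nx1; by rewrite -(z_uniq Cx x2 nx1).
Qed.

(** [W * W0] has order [n * n] and [L] has order [#|B| * n], so [n] divides [#|B|], which is less
    than [2n]. *)
Lemma defL : #|B| = n /\ W * W0 = L.
Proof.
have sWL: W \subset L := subset_trans sWD sDL.
have cM: #|W * W0| = (n * n)%N.
  by rewrite TI_cardMg ?tiWW0 // -conjWf cardJg card_W.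
have cL: #|L| = (#|B| * n)%N.
  by apply: double_inj; rewrite card_evenG cardG doubleMr.
have sM: W * W0 \subset L by rewrite mul_subG ?sW0L.
have kn: #|B| = n.
  have: n %| #|B|.
    rewrite -(dvdn_pmul2r (cardG_gt0 C)) -cL -cM -cent_joinEr ?cWW0 //.
    by apply: cardSg; rewrite join_subG sWL sW0L.
  case/dvdnP=> q qE; have := cardB_lt; have := cardG_gt0 <[f]>; rewrite /= qE.
  rewrite -mul2n ltn_pmul2r ?cardG_gt0 // muln_gt0 => /andP[q0 _] q2.
  by have -> : q = 1%N by [move: q0 q2; clear; lia]; rewrite mul1n.
by split=> //; apply/eqP; rewrite eqEcard sM /= cM cL kn leqnn.
Qed.

Lemma order_f : #[f] = (2 * m)%N. Proof. by rewrite orderE (proj1 defL). Qed.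

(** Conjugation by [f] swaps the factors of [L] and fixes [f ^+ 2], so its two components are
    conjugate under [f]. The component in [W] is killed by the odd [m], hence is no reflection. *)
Lemma f2E : exists al, [/\ al \in W :&: C, al ^ f \in W0, f ^+ 2 = al * al ^ f & #[al] = m].
Proof.
have: f ^+ 2 \in W * W0 by rewrite (proj2 defL) Lf2.
case/mulsgP=> al de Wal W0de fE.
have com x y : x \in W -> y \in W0 -> commute x y.
  by move=> Wx W0y; apply: commute_sym; apply: (centP (subsetP cWW0 _ W0y)).
have W0f: al ^ f \in W0 by rewrite -conjWf memJ_conjg.
have Wdf: de ^ f \in W by rewrite -conjW0f memJ_conjg.
have ti x : x \in W -> x \in W0 -> x = 1.
  by move=> Wx W0x; apply/set1gP; rewrite -tiWW0 inE Wx.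
have deE: de = al ^ f.
  have: (al * de) ^ f = al * de.
    by rewrite -fE conjXg conjgE mulKg.
  rewrite conjMg -(com _ _ Wdf W0f) => e.
  apply/eqP; rewrite eq_mulgV1; apply/eqP/ti.
    have -> : de * (al ^ f)^-1 = al^-1 * (de ^ f).
      by apply: (mulgI al); rewrite mulgA -e mulgK mulKVg.
    by rewrite groupM ?groupV.
  by rewrite groupM ?groupV.
rewrite deE in fE; exists al.
have expE j : f ^+ (2 * j) = al ^+ j * (al ^ f) ^+ j.
  by rewrite expgM fE expgMn //; apply: com.
have alm: al ^+ m = 1.
  have := expE m; rewrite -order_f expg_order => /esym/eqP; rewrite -eq_invg_mul => /eqP e.
  apply: ti; first exact: groupX.
  by rewrite -groupV e groupX.
have Cal: al \in C.
  apply: contraT => nC; have Dal: al \in D :\: C by rewrite inE nC (subsetP sWD).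
  move: alm; rewrite -(odd_double_half m) odd_m expgD -mul2n expgM (invol Dal).
  by rewrite expg1n mulg1 expg1 => e1; rewrite e1 group1 in nC.
split=> //; first by rewrite inE Wal.
apply/eqP; rewrite eqn_dvd !order_dvdn alm eqxx /=.
have: f ^+ (2 * #[al]) == 1 by rewrite expE -conjXg expg_order conj1g mulg1.
by rewrite -order_dvdn order_f dvdn_pmul2l.
Qed.

(** The reflections in [W] are the products of [z ^ f] with even powers of [c]; multiplying by
    [z = c ^+ m], with [m] odd, changes the parity. *)
Lemma D_Wz d : d \in D -> d \notin C -> d \notin W -> z * d \in W.
Proof.
move=> Dd nCd nWd; have Dy := z_gener gener_f; have dD: d \in D :\: C by rewrite inE nCd.
have := mulDC Dy dD; rewrite defC => /cycleP[i e].
have -> : z * d = z ^ f * (z * c ^+ i).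
  have comz: commute z (z ^ f).
    by apply/commgP/conjg_fixP/z_cent; case/setDP: Dy.
  rewrite -e mulgA -comz -mulgA (mulgA (z ^ f)) -(expg2 (z ^ f)).
  by rewrite (invol Dy) mul1g.
rewrite groupM ?W_zf // -expc_m -expgD.
have oi: odd i.
  apply: contraR nWd => ei.
  have -> : d = z ^ f * c ^+ i by rewrite -e mulgA -expg2 (invol Dy) mul1g.
  by rewrite groupM ?W_zf // -(odd_double_half i) (negbTE ei) -mul2n expgM groupX // Wsq ?mem_c.
have: ~~ odd (m + i) by rewrite oddD odd_m oi.
by rewrite -dvdn2 => /dvdnP[q ->]; rewrite mulnC expgM groupX // Wsq ?mem_c.
Qed.

(* Otherwise t = z w with w a reflection in W; modulo the rotations of W and W0, of
   index 8 in G, the elements f and t would be commuting involutions generating G. *)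
Lemma W_t : t \in W.
Proof.
apply: contraT => nWt; have [tD nCt] := setDP Dt.
pose w := z * t; have Ww: w \in W := D_Wz tD nCt nWt.
have tE: t = z * w by rewrite mulgA -expg2 z_sq mul1g.
have nCw: w \in D :\: C by apply: mulCD'.
clearbody w.
have [al [/setIP[Wal Cal] W0af fE oal]] := f2E.
pose E := <[c ^+ 2]>%G.
have sEW: E \subset W by rewrite -[gval E]WC subsetIl.
have sEC: E \subset C by rewrite -[gval E]WC subsetIr.
have sEfW0: E :^ f \subset W0 by rewrite -conjWf conjSg.
have sWfC: E :^ f \subset 'C(E).
  by apply: subset_trans sEfW0 (subset_trans cWW0 (centS sEW)).
pose R0 := (E <*> E :^ f)%G.
have cardR: #|R0| <= m * m.
  have cE: #|E| = m by rewrite -[#|E|]/#[_] order_c2.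
  rewrite /= cent_joinEr // -{1}cE -cE -{2}(cardJg E f).
  by have := mul_cardG E (E :^ f)%G => /= ->; rewrite leq_pmulr ?cardG_gt0.
have nEf2: f ^+ 2 \in 'N(E).
  rewrite fE; apply: groupM; first by rewrite (subsetP (nCsubD sEC)) // (subsetP sCD).
  by rewrite (subsetP (cent_sub _)) // (subsetP (centS sEW)) // (subsetP cWW0).
have nRf: f \in 'N(R0).
  apply/normP; rewrite /= conjYg -conjsgM -expg2 (normP nEf2) joingC //.
have nzEf: z \in 'N(E :^ f).
  have -> : z = (z ^ f^-1) ^ f by rewrite -conjgM mulVg conjg1.
  rewrite normJ memJ_conjg (subsetP (nCsubD sEC)) //.
  by case/setDP: (z_gener (generV gener_f)).
have nwEf: w \in 'N(E :^ f).
  rewrite (subsetP (cent_sub _)) // (subsetP (centS sEfW0)) //.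
  by apply: subsetP Ww; rewrite centsC cWW0.
have nRt: t \in 'N(R0).
  have nEt: t \in 'N(E) by rewrite (subsetP (nCsubD sEC)).
  have nEft: t \in 'N(E :^ f) by rewrite tE groupM.
  by rewrite -sub1set normsY ?sub1set.
pose K1 := (R0 <*> <[t]>)%G.
have sEW_C x : x \in W -> x \in C -> x \in E by move=> Wx Cx; rewrite /= -WC inE Wx.
have sR0K: R0 \subset K1 by apply: joing_subl.
have K1t: t \in K1 by rewrite mem_gen // inE cycle_id orbT.
(* [t] and [t ^ f] differ by a rotation of [W] times the [f]-conjugate of another, so [f] normalises
   [K1]. *)
have tf: t ^ f \in K1.
  have Dy := z_gener gener_f; have DyV := z_gener (generV gener_f).
  have WyV: z ^ f^-1 \in W by rewrite Wz ?groupV ?Gf ?Lf.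
  have Er1: w * z ^ f \in E by rewrite sEW_C ?mulDC // groupM ?W_zf.
  have Er2: z ^ f^-1 * w \in E by rewrite sEW_C ?mulDC // groupM.
  have -> : t ^ f = t * ((w * z ^ f) * (z ^ f^-1 * w) ^ f).
    have zy: commute z (z ^ f).
      by apply/commgP/conjg_fixP/z_cent; case/setDP: Dy.
    have -> : (z ^ f^-1 * w) ^ f = z * w ^ f by rewrite conjMg -conjgM mulVg conjg1.
    rewrite tE conjMg; move: (z ^ f) (w ^ f) zy => y v zy.
    rewrite -!mulgA (mulgA w w) -(expg2 w) (invol nCw) mul1g (mulgA z y) zy.
    by rewrite -mulgA (mulgA z z) -(expg2 z) z_sq mul1g.
  rewrite groupM // (subsetP sR0K) // groupM // mem_gen // inE.
    by rewrite Er1.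
  by rewrite memJ_conjg Er2 orbT.
have nKf: f \in 'N(K1).
  rewrite inE /= conjYg (normP nRf) join_subG sR0K -cycleJ cycle_subG tf //.
have sGK: G \subset K1 * B.
  rewrite -norm_joinEr ?cycle_subG // -genG gen_subG subUset !sub1set.
  by rewrite mem_gen ?inE ?cycle_id ?orbT //= mem_gen // inE K1t.
have f2K: <[f ^+ 2]> \subset K1 :&: B.
  rewrite subsetI cycleX andbT cycle_subG (subsetP sR0K) // fE groupM // mem_gen // inE.
    by rewrite (sEW_C _ Wal Cal).
  by rewrite memJ_conjg (sEW_C _ Wal Cal) orbT.
have cardK1: #|K1| <= #|R0| * 2.
  rewrite /= norm_joinEr ?cycle_subG //; have := mul_cardG R0 <[t]>%G.
  have -> : #|<[t]>%G| = 2.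
    rewrite -[LHS]/#[t]; apply: (@nt_prime_order _ 2); rewrite ?invol //.
    by apply: contraNneq nCt => ->.
  by move=> /= ->; rewrite leq_pmulr ?cardG_gt0.
have kB: #|<[f]>| = (2 * m)%N by rewrite (proj1 defL) nE.
have cf2: #|<[f ^+ 2]>| = m by rewrite -[LHS]/#[_] orderXdiv order_f ?dvdn_mulr // mulKn.
have h1 := mul_cardG K1 <[f]>%G; have h2 := subset_leq_card f2K.
have := subset_leq_card sGK; rewrite cardG; rewrite /= kB nE in h1 *; rewrite cf2 in h2.
(* With [q = m]: [#|K1| <= 2 q^2] and [#|K1 :&: B| >= q] bound [#|K1 * B|] by [4 q^2], whereas
   [#|G| = 8 q^2]. *)
have ar (K R M I q : nat) : K <= R * 2 -> R <= q * q -> (K * (2 * q) = M * I)%N ->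
    q <= I -> 1 < q -> M < (2 * q) * (2 * q).*2.
  clear=> KR Rq e qI q1; rewrite ltnNge; apply/negP=> qM.
  have := leq_mul qM qI; rewrite -e; have: K <= q * q * 2 by lia.
  have: 0 < q * q * q by rewrite !muln_gt0; move: q1; clear; lia.
  move=> q3 /(leq_mul (leqnn (2 * q))); move: q3; clear; nia.
by rewrite leqNgt (ar _ _ _ _ _ cardK1 cardR h1 h2 m_gt1).
Qed.

(** Both [t] and [z ^ f] are reflections in [W], so they differ by a power of [c ^+ 2] and
    [t = z ^ (f * c ^+ j)]. Factoring [f * c ^+ j] in [D * B] removes the part that centralises
    [z]. *)
Lemma t_conj : exists2 b, b \in B & b \notin L /\ t ^ b = z.
Proof.
have Dy := z_gener gener_f.
have: z ^ f * t \in <[c ^+ 2]> by rewrite -WC inE groupM ?W_t ?W_zf // mulDC.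
case/cycleP=> j e; have Ccj: c ^+ j \in C by rewrite groupX ?mem_c.
have tE: t = z ^ (f * c ^+ j).
  rewrite conjgM (conjDC Dy Ccj) -expgM mulnC expgM -e mulgA -(expg2 (z ^ f)).
  by rewrite (invol Dy) mul1g.
have Lc: c ^+ j \in L by rewrite (subsetP sDL) // (subsetP sCD).
have: f * c ^+ j \in D * B by rewrite defGr groupM ?Gf // (subsetP sLG).
case/mulsgP=> d b Dd Bb fcE; exists b^-1; rewrite ?groupV //; split.
  have: f * c ^+ j \notin L by rewrite (groupMr _ Lc) Lf.
  by rewrite fcE (groupMl _ (subsetP sDL _ Dd)).
by rewrite tE fcE conjgM z_cent // -conjgM mulgV conjg1.
Qed.

Lemma structureP : exists a b u, [/\ C :=: <[a]>, b \in D :\: C, u \in B &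
  forall j, tr (u * f ^+ j) = if odd j then a ^+ j else b * a ^+ j].
Proof.
have [al [/setIP[Wal Cal] W0af fE oal]] := f2E.
have [b Bb [nLb tb]] := t_conj.
have com x y : x \in W -> y \in W0 -> commute x y.
  move=> Wx W0y; apply: commute_sym; exact: (centP (subsetP cWW0 _ W0y)).
have comz: commute z al by apply: (centsP (cyclic_abelian cycC)).
have Dal j : al ^+ j \in D by rewrite groupX // (subsetP sCD).
have f2l l : f ^+ (2 * l) = al ^+ l * (al ^ f) ^+ l.
  by rewrite expgM fE expgMn //; apply: com.
have comAE l : commute (al ^+ l) ((al ^ f) ^+ l) by apply: com; rewrite groupX.
have inv_fix d l : d \in D :\: C -> al ^+ l * d * al ^+ l = d.
  by move=> Dd; rewrite (conjgC _ d) (conjCD Dd) ?groupX // mulgKV.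
(* [aux] serves [t], which inverts [al] and centralises [al ^ f]; [aux2] serves [z], which does the
   opposite. *)
have aux (x A E : gT) : commute A E -> commute x E -> A * x * A = x ->
    x * (A * E) = A * E * (x * (A * A)).
  move=> cAE cxE e; have -> : A * E * (x * (A * A)) = E * (A * x * A) * A.
    by rewrite cAE !mulgA.
  by rewrite e -cxE -!mulgA cAE.
have aux2 (x A E : gT) : commute A E -> commute x A -> E * x * E = x ->
    x * (A * E) = (A * E)^-1 * (x * (A * A)).
  move=> cAE cxA e; apply: (mulgI (A * E)); rewrite mulKVg.
  have -> : A * E * (x * (A * E)) = A * (E * x * E) * A by rewrite {2}cAE !mulgA.
  by rewrite e -cxA -!mulgA.
have tev l : tr (f ^+ (2 * l)) = t * al ^+ (2 * l).
  apply: (@trE _ (f ^+ (2 * l))); rewrite ?mem_cycle // ?groupM ?Dal //.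
    by case/setDP: Dt.
  rewrite f2l mul2n -addnn expgD; apply: aux; first exact: comAE.
    by apply: com; rewrite ?W_t ?groupX.
  exact: inv_fix.
have tod l : tr (b * f ^+ (2 * l)) = z * al ^+ (2 * l).
  apply: (@trE _ (b * f ^- (2 * l))); rewrite ?groupM ?groupV ?mem_cycle ?Dal //.
    by rewrite (subsetP sCD).
  have -> : t * (b * f ^+ (2 * l)) = b * (z * f ^+ (2 * l)).
    by rewrite mulgA (conjgC t) tb -mulgA.
  rewrite -mulgA f2l mul2n -addnn expgD; congr (_ * _); apply: aux2; first exact: comAE.
    by apply: commuteX.
  have zE: z = (z ^ f^-1) ^ f by rewrite -conjgM mulVg conjg1.
  by rewrite -conjXg {1}zE -!conjMg inv_fix -?zE // z_gener ?generV ?gener_f.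
have alm: al ^+ m = 1 by rewrite -oal expg_order.
have [i uE]: exists i, b * f ^+ m = f ^+ (2 * i).
  case/cycleP: Bb nLb => i ->; rewrite LfX negbK -expgD => oi.
  have: ~~ odd (i + m) by rewrite oddD oi odd_m.
  by rewrite -dvdn2 => /dvdnP[q ->]; exists q; rewrite mulnC.
(* Even powers of [f] after 1 give reflections ([tev]), after [b] rotations ([tod]). Starting at
   [b * f ^+ m], an even power of [f], makes parities alternate; [al ^+ m = 1] then removes the
   shift by [m]. *)
exists (z * al), (t * al ^+ (2 * i)), (b * f ^+ m).
have aX j : (z * al) ^+ j = z ^+ (odd j) * al ^+ j.
  rewrite expgMn //; congr (_ * _); rewrite -{1}(odd_double_half j) expgD -mul2n expgM.
  by rewrite z_sq expg1n mulg1.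
split.
- apply/eqP; rewrite eq_sym eqEcard cycle_subG groupM //= nE -[#|<[_]>|]/#[_].
  have oz := nt_prime_order (isT : prime 2) z_sq z_neq1.
  by rewrite orderM ?oz ?oal // coprime2n odd_m.
- by rewrite mulDC' // groupX.
- by rewrite groupM ?mem_cycle.
move=> j; rewrite aX; case: ifP => oj.
  have: ~~ odd (m + j) by rewrite oddD oj odd_m.
  rewrite -dvdn2 => /dvdnP[l lE]; rewrite -mulgA -expgD lE mulnC tod mulnC -lE.
  by rewrite oj expgD alm mul1g expg1.
rewrite oj expg0 mul1g; have: ~~ odd j by rewrite oj.
rewrite -dvdn2 => /dvdnP[l lE]; rewrite uE lE (mulnC l) -expgD -mulnDr tev.
by rewrite mulnDr expgD mulgA.
Qed.

End Structure.

End NoRegularOrbit.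

(** * Excluding orbits of length [n] *)

Section RegularOrbit.

Variable s0 : gT.
Hypothesis Bs0 : s0 \in B.
Hypothesis gs0 : s0 \in gener.
Hypothesis reg : C :&: D :^ s0^-1 = 1.
Local Notation S := (orb s0).

Lemma reg1 c : c \in C -> c ^ s0 \in D -> c = 1.
Proof. by move=> Cc Dcs; apply/set1gP; rewrite -reg inE Cc mem_conjgV. Qed.

Lemma card_S : #|S| = n.
Proof. by rewrite -[RHS](card_orb Bs0) reg cards1 muln1. Qed.

(** The [C]-orbit of [s0 *: D] is a [D]-orbit: as there are fewer than [#|D|] cosets, some
    non-trivial [d0] in [D] fixes this one. It is a reflection, and every other reflection is a
    rotation times [d0]. *)
Lemma DsC d : d \in D -> exists c e, [/\ c \in C, e \in D & d * s0 = c * s0 * e].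
Proof.
move=> Dd; case Cd: (d \in C); first by exists d, 1; rewrite group1 mulg1.
have /trivgPn[d0]: D :&: D :^ s0^-1 != 1.
  apply/eqP=> ti; have cDD := TI_cardMg ti.
  have: (D * (D :^ s0^-1)) \subset G.
    by rewrite mul_subG ?sDG // -(conjGid (groupVr (subsetP sBG _ Bs0))) conjSg sDG.
  move/subset_leq_card; rewrite cDD cardJg cardG cardD leq_pmul2r; last first.
    by move: C_ge5; clear; lia.
  by rewrite leqNgt cardB_lt.
case/setIP=> Dd0; rewrite mem_conjgV => Dd0s d0n1.
have d0D: d0 \in D :\: C.
  by rewrite inE Dd0 andbT; apply: contra d0n1 => Cd0; apply/eqP/reg1.
have dD: d \in D :\: C by rewrite inE Cd.
exists (d * d0), (d0 ^ s0); rewrite Dd0s (mulDC dD d0D); split=> //.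
by rewrite -!mulgA -conjgC (mulgA d0) -expg2 (invol d0D) mul1g.
Qed.

Lemma S_closed d u e : d \in D -> e \in D -> u \in S -> d * u * e \in B -> d * u * e \in S.
Proof.
move=> Dd De /orbP[Bu [c [d' [Cc Dd' ->]]]] Bx; apply/orbP; split=> //.
have Ddc: d * c \in D by rewrite groupM // (subsetP sCD).
have [c1 [e1 [Cc1 De1 eq]]] := DsC Ddc; exists c1, (e1 * d' * e).
rewrite !groupM //; split=> //.
by rewrite (mulgA d) (mulgA d) eq !mulgA.
Qed.

Definition sqrt1 := [set c in C | c ^+ 2 == 1].
Local Notation I2 := sqrt1.

(** If [t] fixes the cosets of [b] and of [c * b], then [c ^+ 2] fixes the coset of [b], so
    [c ^+ 2 = 1] by regularity. *)
Lemma card_fixS : #|fixt :&: S| <= #|I2|.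
Proof.
have [-> | [b /setIP[/setIdP[Bb Dtb] Sb]]] := set_0Vmem (fixt :&: S); first by rewrite cards0.
apply: leq_trans (leq_imset_card (fun c => divgr B D (c * b)) _); apply: subset_leq_card.
apply/subsetP=> u /setIP[/setIdP[Bu Dtu] Su].
case/orbP: Sb => _ [c1 [d1 [Cc1 Dd1 bE]]]; case/orbP: Su => _ [c2 [d2 [Cc2 Dd2 uE]]].
have uE': u = (c2 * c1^-1) * b * (d1^-1 * d2).
  by rewrite uE bE !mulgA mulgKV mulgK.
set c := c2 * c1^-1 in uE'; have Cc: c \in C by rewrite groupM ?groupV.
have De: d1^-1 * d2 \in D by rewrite groupM ?groupV.
apply/imsetP; exists c; last first.
  have -> : c * b = u * (d1^-1 * d2)^-1 by rewrite uE' mulgK.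
  by rewrite divgrMid ?groupV.
rewrite inE Cc; apply/eqP/reg1; first exact: groupX.
have: t ^ (c * b) \in D by move: Dtu; rewrite uE' conjgM (groupJr _ De).
rewrite conjgM (conjDC Dt Cc) conjMg (groupMl _ Dtb) bE 2!conjgM (groupJr _ Dd1).
have -> // : (c ^+ 2) ^ c1 = c ^+ 2.
by apply/conjg_fixP/commgP/(centsP (cyclic_abelian cycC)) => //; apply: groupX.
Qed.

Lemma tr_rot b : b \in B -> b \notin fixt -> tr b \in C :\: I2.
Proof.
move=> Bb; rewrite inE Bb /= tr_fix // => nx.
have Cx: tr b \in C by apply: contraR nx => nC; rewrite invol // inE nC trD.
by rewrite !inE Cx (negbTE nx).
Qed.

Lemma card_notfix : #|B :\: fixt| <= #|C :\: I2|.
Proof.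
rewrite -(card_in_imset (f := tr) (D := mem (B :\: fixt))); last first.
  by move=> b c /setDP[Bb _] /setDP[Bc _]; apply: tr_inj.
apply/subset_leq_card/subsetP=> _ /imsetP[b /setDP[Bb nb] ->]; exact: tr_rot.
Qed.

Lemma sI2C : I2 \subset C. Proof. by apply/subsetP=> c /setIdP[]. Qed.

(* t fixes at most #|I2| points of S, and has at least #|B| - n + #|I2| fixed points
   since B :\: fixt embeds in C :\: I2; both bounds are therefore attained. *)
Lemma fixt_all : B :\: S \subset fixt /\ tr @: (B :\: fixt) = C :\: I2.
Proof.
have inj: {in B :\: fixt &, injective tr}.
  by move=> b c /setDP[Bb _] /setDP[Bc _]; apply: tr_inj.
have sfB: fixt \subset B by apply/subsetP=> b /setIdP[].
have h1 := card_fixS; have h2 := card_notfix; have h3 := cardsID S fixt.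
have h4 := cardsID fixt B; rewrite (setIidPr sfB) in h4.
have h5 := cardsID I2 C; rewrite (setIidPr sI2C) in h5.
have h6 := cardsID S B; rewrite (setIidPr (subsetIl _ _)) card_S in h6.
have s1: fixt :\: S \subset B :\: S by apply: setSD.
have h7 := subset_leq_card s1.
have ar (F k FS FnS BnF CnI I N BnS : nat) : FS <= I -> BnF <= CnI -> (FS + FnS = F)%N ->
  (F + BnF = k)%N -> (I + CnI = N)%N -> (N + BnS = k)%N -> FnS <= BnS ->
  FnS = BnS /\ BnF = CnI by clear; lia.
have [e1 e2] := ar _ _ _ _ _ _ _ _ _ h1 h2 h3 h4 h5 h6 h7.
have /eqP <- : fixt :\: S == B :\: S by rewrite eqEcard s1 e1 leqnn.
split; first exact: subsetDl.
apply/eqP; rewrite eqEcard card_in_imset // e2 leqnn andbT.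
by apply/subsetP=> _ /imsetP[b /setDP[Bb nb] ->]; exact: tr_rot.
Qed.

(** For [u] outside [S], [t] fixes the cosets of [u] and of [c * u], so [(c ^+ 2) ^ u] lies in [D],
    even in [C] as [c ^+ 4 != 1]. Conversely [S] lies in [gener]. The complement of [S] is thus a
    subgroup. *)
Lemma compl_S c : C :=: <[c]> -> c ^+ 4 != 1 -> B :\: S = 'N_B(<[c ^+ 2]>).
Proof.
move=> defC c4; have Cc: c \in C by rewrite defC cycle_id.
have Cc2: c ^+ 2 \in C by rewrite groupX.
apply/setP=> u; rewrite in_setD [RHS]inE andbC; case Bu: (u \in B) => //=.
apply/idP/idP=> [nSu | nu]; last first.
  apply: contra c4 => Su; have gu := subsetP (orb_gener gs0) _ Su.
  have: (c ^+ 2) ^ u \in C.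
    have: (c ^+ 2) ^ u \in <[c ^+ 2]> by rewrite memJ_norm ?cycle_id.
    by apply: subsetP; rewrite cycle_subG.
  by move/(gener_conj gu Cc2) => e; rewrite -[4]/(2 * 2)%N expgM e expg1n.
have sfix := subsetP (proj1 fixt_all).
have /setIdP[_ Dtu]: u \in fixt by rewrite sfix // inE nSu.
have: c * u \in B * D by rewrite defG groupM ?(subsetP sBG u) // (subsetP sDG) // (subsetP sCD).
case/mulsgP=> v d Bv Dd e.
have vE: v = c * u * d^-1 by rewrite e mulgK.
have nSv: v \notin S.
  apply: contra nSu => Sv; have uE: u = c^-1 * v * d by rewrite vE -!mulgA mulVg mulg1 mulKg.
  by rewrite uE S_closed // -?uE // groupV (subsetP sCD).
have /setIdP[_ Dtv]: v \in fixt by rewrite sfix // inE nSv.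
have: t ^ (c * u) \in D by rewrite e conjgM groupJ.
rewrite conjgM (conjDC Dt Cc) conjMg (groupMl _ Dtu) => Dcu.
have Ccu: (c ^+ 2) ^ u \in C.
  apply: contraR c4 => nC; have /invol: (c ^+ 2) ^ u \in D :\: C by rewrite inE nC.
  by rewrite -conjXg -expgM => e1; rewrite -(conjgK u (c ^+ 4)) e1 conj1g.
by apply: norm_subC; rewrite ?cycle_subG // -cycleJ cycle_subG.
Qed.

(** The order of the subgroup [B :\: S] divides [#|B|], hence [n]; it is not [n] because
    [#|B| < 2n]. *)
Lemma card_compl_S : [/\ #|B| = (n + #|B :\: S|)%N, 0 < #|B :\: S| & 2 * #|B :\: S| <= n].
Proof.
have [c defC c4] := C_generator; have e := compl_S defC c4.
have h1 := cardsID S B; rewrite (setIidPr (subsetIl _ _)) card_S in h1.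
have e_gt0: 0 < #|B :\: S| by rewrite e cardG_gt0.
have: #|B :\: S| %| #|B| by rewrite e cardSg ?subsetIl.
rewrite -h1 dvdn_addl // => /dvdnP[q nE]; have lt := cardB_lt; rewrite -h1 -addnn ltn_add2l in lt.
split=> //; case: q nE => [|[|q]] nE; rewrite nE ?mul1n ?ltnn // in lt *.
by rewrite leq_mul2r orbT.
Qed.

(** X contains every rotation that does not square to 1, so [J] is trivial or generated by the
    involution of [C]. In the latter case no rotation of X is an involution, and all fixed points of
    [t] come from reflections. *)
Lemma connI : exists J : {group gT}, [/\ J \subset C, Q = C :\: J &
  #|J| = 1%N \/ #|J| = 2 /\ refl = fixt].
Proof.
have sQ: Q \subset C :\ 1.
  apply/subsetP=> _ /setIP[/imsetP[b Bb ->] Cx]; rewrite in_setD1 Cx andbT; exact: tr_neq1.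
have Qsub x : x \in C -> x ^+ 2 != 1 -> x \in Q.
  move=> Cx x2; have: x \in C :\: I2 by rewrite !inE Cx (negbTE x2).
  rewrite -(proj2 fixt_all) => /imsetP[b /setDP[Bb _] xE].
  by rewrite in_setI Cx andbT xE imset_f.
have [sC | ] := boolP (C :\ 1 \subset Q).
  exists 1%G; rewrite sub1G cards1; split=> //; last by left.
  by apply/eqP; rewrite eqEsubset sQ.
case/subsetPn=> z /setD1P[nz1 Cz] nQz.
have z2: z ^+ 2 = 1 by apply/eqP; apply: contraR nQz => /(Qsub _ Cz).
have oz := nt_prime_order (isT : prime 2) z2 nz1.
have Jz: <[z]> = [set 1; z] by apply: cycle2g.
exists <[z]>%G; rewrite cycle_subG; split=> //.
  apply/setP=> x; rewrite in_setD /= Jz; apply/idP/andP=> [Qx | [nJ Cx]].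
    have /setD1P[nx1 Cx] := subsetP sQ _ Qx; split=> //.
    by rewrite !inE (negbTE nx1) /=; apply: contraTneq Qx => ->.
  apply: Qsub => //; move: nJ; rewrite !inE negb_or => /andP[nx1 nxz].
  by apply: contra nxz => /eqP x2; apply/eqP/sqrt1_uniq.
right; split; first exact: oz.
apply/eqP; rewrite eqEsubset refl_sub_fix /=; apply/subsetP=> b /setIdP[Bb Dtb].
rewrite reflP // inE Dtb andbT; apply: contra nQz => Ctb.
have <- : t ^ b = z.
  apply: sqrt1_uniq => //; first by rewrite -conjXg invol ?conj1g.
  by rewrite -tr_fixE // tr_neq1.
by rewrite in_setI Ctb andbT -tr_fixE // imset_f.
Qed.

Lemma card_QQ (J : {group gT}) : J \subset C -> Q = C :\: J ->
  (\sum_(y in Q) #|Q :&: Q :* y| = (n - #|J|) * (n - #|J|.*2))%N.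
Proof.
move=> sJC ->; have cC: #|C :\: J| = (n - #|J|)%N by rewrite cardsD (setIidPr sJC).
rewrite -cC -sum_nat_const; apply: eq_bigr => y /setDP[Cy nJy].
have -> : (C :\: J) :&: (C :\: J) :* y = C :\: (J :|: J :* y).
  apply/setP=> x; rewrite in_setI mem_rcoset !in_setD in_setU mem_rcoset negb_or.
  case Cx: (x \in C); rewrite ?andbF // !andbT.
  by rewrite (groupMl _ Cx) groupV Cy andbT.
have sJy: J :* y \subset C by rewrite mul_subG ?sub1set.
rewrite cardsD (setIidPr _) ?subUset ?sJC // cardsU card_rcoset -addnn.
have -> : J :&: J :* y = set0.
  apply/setP=> x; rewrite !inE mem_rcoset; apply/negP=> /andP[Jx].
  by rewrite groupMl // groupV (negbTE nJy).
by rewrite cards0 subn0.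
Qed.

(* The quotients of pairs of elements of refl that lie in S are pairwise distinct
   by refl_gener_inj; there are 4 e + 2 of them, where e = #|B :\: S|. *)
Lemma refl_quotients : refl = fixt -> #|refl| = (#|B :\: S| + 2)%N ->
  4 * #|B :\: S| + 2 <= n.
Proof.
move=> rf cr; have [c defC c4] := C_generator; have dE := compl_S defC c4.
pose E := 'N_B(<[c ^+ 2]>)%G.
have sEr: E \subset refl by rewrite /= -dE rf (proj1 fixt_all).
have BS b : b \in B -> b \notin E -> b \in S.
  by move=> Bb; rewrite /= -dE inE Bb andbT negbK.
have rB b : b \in refl -> b \in B by case/setIdP.
have h : (\sum_(b in refl) #|[set g in S | (b * g)%g \in refl]| <= n)%N.
  rewrite -card_S -sum1_card; under eq_bigr do rewrite card_condE.
  rewrite exchange_big /=; apply: leq_sum => g Sg; rewrite -card_condE.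
  apply/card_le1P => b /setIdP[rb rbg] x; apply/setIdP/idP.
    case=> rx rxg; rewrite inE; apply/eqP/(@refl_gener_inj _ _ g) => //.
      by case/orbP: Sg.
    exact: (subsetP (orb_gener gs0)).
  by rewrite inE => /eqP ->.
have lowE b : b \in E -> 2 <= #|[set g in S | b * g \in refl]|.
  move=> Eb; have c2: #|refl :\: E| = 2.
    by rewrite cardsD (setIidPr sEr) cr dE addKn.
  rewrite -c2 -(card_lcoset (refl :\: E) b^-1); apply/subset_leq_card/subsetP=> x.
  rewrite mem_lcoset invgK => /setDP[rbx nE]; rewrite inE rbx andbT.
  have Bb := rB _ (subsetP sEr _ Eb).
  apply: BS; first by rewrite -(groupMl _ Bb) rB.
  by rewrite -(groupMl _ Eb).
have lowU b : b \in refl :\: E -> #|B :\: S|.+1 <= #|[set g in S | b * g \in refl]|.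
  case/setDP=> rb nEb; have Bb := rB _ rb; have Sb := BS _ Bb nEb.
  have c1: #|refl :\ b| = #|B :\: S|.+1 by have := cardsD1 b refl; rewrite rb cr addn2 => -[].
  rewrite -c1 -(card_lcoset (refl :\ b) b^-1); apply/subset_leq_card/subsetP=> x.
  rewrite mem_lcoset invgK => /setD1P[nb rbx]; rewrite inE rbx andbT.
  have Bx: x \in B by rewrite -(groupMl _ Bb) rB.
  apply: BS => //; apply: contra nb => Ex.
  have cbx: b * x = x * b by apply: (centsP (cycle_abelian f)).
  have: 1 = x; last by move=> <-; rewrite mulg1.
  apply: (@refl_gener_inj _ _ b); rewrite ?refl1 ?mul1g -?cbx ?(subsetP sEr x) //.
  exact: (subsetP (orb_gener gs0) _ Sb).
move: h; rewrite (big_setID E) /= (setIidPr sEr) => h.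
have l1: (#|B :\: S| * 2 <= \sum_(b in E) #|[set g in S | (b * g)%g \in refl]|)%N.
  by rewrite {1}dE -sum_nat_const; apply: leq_sum.
have l2: (2 * #|B :\: S|.+1 <= \sum_(b in refl :\: E) #|[set g in S | (b * g)%g \in refl]|)%N.
  have <- : #|refl :\: E| = 2 by rewrite cardsD (setIidPr sEr) cr dE addKn.
  by rewrite -sum_nat_const; apply: leq_sum.
by have := leq_trans (leq_add l1 l2) h; move: #|B :\: S| #|C|; clear; lia.
Qed.

Lemma no_regular_orbit : False.
Proof.
have [kE e0 en] := card_compl_S; have [J [sJC QE Jcard]] := connI.
have [w wr eq] := triangle_count; rewrite (card_QQ sJC QE) in eq.
have rE: #|F| = (#|B :\: S| + #|J|)%N.
  have := cardsID C X; rewrite QE cardsD (setIidPr sJC) card_in_imset; last exact: tr_inj.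
  rewrite kE; have := subset_leq_card sJC; move: #|_| #|_| #|_| #|_|; clear; lia.
have sE: #|Q| = (n - #|J|)%N by rewrite QE cardsD (setIidPr sJC).
rewrite rE sE in wr eq.
case: Jcard => [J1 | [J2 rf]].
  (* The count reads [(N-1)(N-2) = w(2N-3-e)] with [w <= e] and [2e <= N]; the right side is at most
     [3N(N-2)/4], too small for [N >= 5]. *)
  rewrite J1 in wr eq; move: wr eq en e0 C_ge5.
  move: #|B :\: S| #|C|; clear=> e N wr eq en e0 N5.
  have [d dE]: exists d, N = (e + d.+3)%N by exists (N - e - 3)%N; lia.
  subst N; nia.
have cr: #|refl| = (#|B :\: S| + 2)%N by rewrite -card_connD rE J2.
have := refl_quotients rf cr; rewrite J2 in wr eq; move: wr eq en e0 C_ge5.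
move: #|B :\: S| #|C|; clear=> e N wr eq en e0 N5 eN.
(* Here [(N-2)(N-4) = w(2N-6-e)] with [w <= e+1] and [4e+2 <= N]. Size alone excludes [N >= 8]; for
   [N = 6, 7] divisibility does. *)
have [N7 | N8] := leqP N 7.
  have ee: e = 1%N by move: eN N7 e0; clear; lia.
  have [NE | NE]: N = 6 \/ N = 7 by move: eN N7 e0; clear; lia.
    by move: eq; rewrite NE ee; clear; lia.
  by move: eq; rewrite NE ee; clear; lia.
have [d dE]: exists d, N = (8 + d)%N by exists (N - 8)%N; move: N8; clear; lia.
by subst N; move: wr eq eN e0; clear; nia.
Qed.

End RegularOrbit.

(** Without regular orbits, every coset given by [gener] has an involution in its stabiliser in [C].
    It is always the same [z], since [C] is cyclic. *)
Theorem factorization_structure : exists m, [/\ n = (2 * m)%N, odd m &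
  exists a b u, [/\ C :=: <[a]>, b \in D :\: C, u \in B &
    forall j, tr (u * f ^+ j) = if odd j then a ^+ j else b * a ^+ j]].
Proof.
have noreg b : b \in B -> b \in gener -> exists c, [/\ c \in C, c ^ b \in D :\: C,
    c ^+ 2 = 1 & c != 1].
  move=> Bb gb; have /trivgPn[c /setIP[Cc]]: C :&: D :^ b^-1 != 1.
    by apply/eqP; apply: no_regular_orbit.
  rewrite mem_conjgV => Dcb nc1; have Dcb': c ^ b \in D :\: C.
    by rewrite inE Dcb andbT; apply: contra nc1 => Ccb; apply/eqP/(gener_conj gb).
  exists c; split=> //; apply: (conjg_inj b); by rewrite conjXg invol ?conj1g.
have [z [Cz _ z2 nz1]] := noreg f (cycle_id f) gener_f.
have zg : {in gener, forall g, z ^ g \in D :\: C}.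
  move=> g gg; have: g \in B * D by rewrite defG generG.
  case/mulsgP=> b d Bb Dd gE; have gb: b \in gener by move: gg; rewrite gE generMr.
  have [c [Cc Dcb c2 nc1]] := noreg b Bb gb.
  rewrite gE conjgM (sqrt1_uniq Cz Cc) //; case/setDP: Dcb => Dcb nC.
  apply/setDP; split; first exact: groupJ.
  by rewrite memJ_norm // (subsetP (normal_norm nCD)).
have [m om nE] := odd_half_n Cz nz1 z2 zg; exists m; split=> //.
have [c defC c4] := C_generator.
exact: (structureP Cz nz1 z2 zg om nE defC c4).
Qed.

End CyclicDihedralFactorization.

(** * Vertex permutations induced by map automorphisms *)

Section VertexAutomorphisms.

Variables (gT : finGroupType) (M : cayley_map gT).
Local Notation X := (cm_set M).
Local Notation p := (cm_perm M).

Lemma cm_perm_closed x : (p x \in X) = (x \in X).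
Proof. exact: (perm_closed _ (cm_on M)). Qed.

Lemma cm_permX_closed i x : x \in X -> (p ^+ i) x \in X.
Proof.
by move=> Xx; elim: i => [|i IH]; rewrite ?perm1 // expgSr permM cm_perm_closed.
Qed.

Lemma cm_permX x y : x \in X -> y \in X -> exists i, y = (p ^+ i) x.
Proof.
move=> Xx; rewrite -(cm_cyclic Xx) => /porbitP[i ->]; by exists i.
Qed.

(** An induced permutation is prescribed on initial vertices only; commuting with the dart reversal
    determines terminal vertices too. *)
Lemma vertex_autP s : s \in vertex_aut M -> forall g x, x \in X ->
  (s g)^-1 * s (g * x) \in X /\ (s g)^-1 * s (g * p x) = p ((s g)^-1 * s (g * x)).
Proof.
rewrite inE => /exists_inP[phi /centP cphi /forallP sphi] g x Xx.
have crev: phi * rev_perm M = rev_perm M * phi := cphi _ (set22 _ _).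
have crot: phi * rot_perm M = rot_perm M * phi := cphi _ (set21 _ _).
have dP y : y \in X -> (g, g * y).1^-1 * (g, g * y).2 \in X by rewrite /= mulKg.
pose d y (Xy : y \in X) : dart M := Sub (g, g * y) (dP y Xy).
have phiE y (Xy : y \in X) : val (phi (d y Xy)) = (s g, s (g * y)).
  rewrite [LHS]surjective_pairing (eqP (sphi _)) /=; congr (_, _).
  have := congr1 (fun q : {perm dart M} => (val (q (d y Xy))).1) crev.
  by rewrite !permM /= !permE (eqP (sphi _)).
have Xpx: p x \in X by rewrite cm_perm_closed.
split; first by have := valP (phi (d x Xx)); rewrite phiE.
have := congr1 (fun q : {perm dart M} => (val (q (d x Xx))).2) crot.
rewrite !permM /= !permE /= /rot_pair phiE /=.
have -> : dart_rot (d x Xx) = d (p x) Xpx.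
  by apply: val_inj; rewrite /= /rot_pair /= mulKg.
by rewrite phiE /= => <-; rewrite mulKg.
Qed.

Lemma vertex_autX s i g x : s \in vertex_aut M -> x \in X ->
  (s g)^-1 * s (g * (p ^+ i) x) = (p ^+ i) ((s g)^-1 * s (g * x)).
Proof.
move=> As Xx; elim: i => [|i IH]; first by rewrite !perm1.
rewrite expgSr !permM -IH; case: (vertex_autP As g (x := (p ^+ i) x)) => //.
exact: cm_permX_closed.
Qed.

(** Fixing one arc at a vertex fixes all arcs there, because the rotation is cyclic; this spreads
    along edges, and X generates the group. *)
Lemma vertex_aut_fix s x : s \in vertex_aut M -> x \in X -> s 1 = 1 -> s x = x -> s = 1.
Proof.
move=> As Xx s1 sx; pose P g := [&& s g == g & [forall y in X, s (g * y) == g * y]].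
have Pall g y : s g = g -> y \in X -> s (g * y) = g * y -> P g.
  move=> sg Xy sgy; rewrite /P sg eqxx; apply/forall_inP=> u Xu.
  have [i ->] := cm_permX Xy Xu; have := vertex_autX i g As Xy.
  by rewrite sg sgy mulKg => /(canRL (mulKVg _)) ->.
have PX g y : P g -> y \in X -> P (g * y).
  case/andP=> /eqP sg /forall_inP sgX Xy; have /eqP sgy := sgX _ Xy.
  apply: (Pall _ y^-1); rewrite ?mulgK //.
  by rewrite -(cm_inv M) inE invgK.
have P1: P 1 by apply: (Pall _ x); rewrite ?mul1g.
pose H := [set h | [forall g, P g ==> P (g * h)]].
have gH: group_set H.
  apply/group_setP; split=> [|h k]; rewrite !inE.
    by apply/forallP=> g; rewrite mulg1 implybb.
  move=> /forallP Hh /forallP Hk; apply/forallP=> g; apply/implyP=> Pg.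
  by rewrite mulgA (implyP (Hk _)) // (implyP (Hh _)).
have sXH: X \subset Group gH.
  apply/subsetP=> y Xy; rewrite inE; apply/forallP=> g; apply/implyP=> Pg; exact: PX.
apply/permP=> g; rewrite perm1; have: g \in Group gH.
  by move: sXH; rewrite -gen_subG (cm_gen M) => /subsetP; apply; rewrite inE.
by rewrite inE => /forallP/(_ 1)/implyP/(_ P1); rewrite mul1g => /andP[/eqP].
Qed.

Lemma rot_permX i (d : dart M) :
  val ((rot_perm M ^+ i) d) = ((val d).1, (val d).1 * (p ^+ i) ((val d).1^-1 * (val d).2)).
Proof.
elim: i => [|i IH]; first by rewrite !perm1 mulKVg -surjective_pairing.
rewrite !expgSr !permM [rot_perm M _]permE /= /rot_pair IH /= mulKg //.
Qed.

Lemma rot_permXP (d d' : dart M) : (val d).1 = (val d').1 ->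
  exists i, d' = (rot_perm M ^+ i) d.
Proof.
move=> e; have [i ei] := cm_permX (valP d) (valP d'); exists i.
by apply: val_inj; rewrite rot_permX -ei e mulKVg -surjective_pairing.
Qed.

(** Regularity gives an automorphism turning the dart from 1 to [x0] one step. It acts on vertices
    because darts with the same origin differ by a power of the rotation. *)
Lemma rotation_aut x0 : x0 \in X -> regular_map M ->
  exists2 f, f \in vertex_aut M & f 1 = 1 /\ {in X, f =1 p}.
Proof.
move=> Xx0 reg.
have dP g : (g, g * x0).1^-1 * (g, g * x0).2 \in X by rewrite /= mulKg.
pose d g : dart M := Sub (g, g * x0) (dP g).
have [phi Aphi phi1] := atransP2 reg (in_setT (d 1)) (in_setT (rot_perm M (d 1))).
have /centP cphi := Aphi.
have crev: phi * rev_perm M = rev_perm M * phi := cphi _ (set22 _ _).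
have crot i e : phi ((rot_perm M ^+ i) e) = (rot_perm M ^+ i) (phi e).
  by rewrite -!permM (commuteX i (cphi _ (set21 _ _))).
have fst_eq e e' : (val e).1 = (val e').1 -> (val (phi e)).1 = (val (phi e')).1.
  by case/rot_permXP=> i ->; rewrite crot rot_permX.
have s_inj : injective (fun g => (val (phi (d g))).1).
  move=> g h /rot_permXP[i]; rewrite -crot => /perm_inj /(congr1 (fun e => (val e).1)).
  by rewrite rot_permX.
pose s := perm s_inj; have As: s \in vertex_aut M.
  rewrite inE; apply/exists_inP; exists phi => //; apply/forallP=> e.
  by rewrite permE; apply/eqP/fst_eq.
have phi1' : phi (d 1) = rot_perm M (d 1) by rewrite phi1.
have s1: s 1 = 1 by rewrite permE phi1' permE.
have sx0: s x0 = p x0.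
  have := congr1 (fun q : {perm dart M} => (val (q (d 1))).1) crev.
  rewrite !permM permE /= phi1' permE /rot_pair /= invg1 !mul1g => ->.
  by rewrite permE; apply: fst_eq; rewrite permE /= mul1g.
exists s => //; split=> // x Xx; have [i ->] := cm_permX Xx0 Xx.
have := vertex_autX i 1 As Xx0; rewrite s1 invg1 !mul1g sx0 => ->.
by rewrite -!permM -expgS expgSr.
Qed.

End VertexAutomorphisms.

(** * Dihedral generating pairs and their isomorphisms *)

Section DihedralPair.

Variables (gT : finGroupType) (n : nat).
Hypothesis n_gt0 : 0 < n.
Hypothesis card_gT : #|[set: gT]| = n.*2.

Section Elements.

Variables a b : gT.
Hypothesis a_n : a ^+ n = 1.
Hypothesis b_2 : b ^+ 2 = 1.
Hypothesis ba_ba : b * a * b * a = 1.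
Hypothesis gen_ab : <<[set a; b]>> = [set: gT].

Lemma dihedral_conj : a ^ b = a^-1.
Proof.
have bV: b^-1 = b by apply/eqP; rewrite eq_invg_mul -expg2 b_2.
by apply: invg_inj; apply/eqP; rewrite invgK eq_invg_mul conjgE bV !mulgA ba_ba.
Qed.

Lemma dihedral_mul : <[a]> * <[b]> = [set: gT].
Proof.
rewrite -norm_joinEr ?cycle_subG; last first.
  by rewrite inE -cycleJ dihedral_conj cycleV.
by apply/eqP; rewrite eqEsubset subsetT -gen_ab genS // setUSS // sub1set cycle_id.
Qed.

(** The relations bound the orders by [n] and 2, and the group order [n.*2] forces equality. *)
Lemma dihedral_orders : [/\ #[a] = n, #[b] = 2 & <[a]> :&: <[b]> = 1].
Proof.
have e := mul_cardG <[a]> <[b]>; rewrite /= dihedral_mul card_gT -!orderE in e.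
have h1 := cardG_gt0 (<[a]> :&: <[b]>).
have ha: #[a] <= n by rewrite dvdn_leq // order_dvdn a_n.
have hb: #[b] <= 2 by rewrite dvdn_leq // order_dvdn b_2.
have ar (x y k z : nat) : y <= 2 -> x <= k -> 0 < k -> 0 < z -> (x * y = k.*2 * z)%N ->
    [/\ x = k, y = 2 & z = 1%N].
  by clear; move=> *; split; nia.
have [-> -> c1] := ar _ _ _ _ hb ha n_gt0 h1 e; split=> //.
by apply/eqP; rewrite trivg_card1 c1.
Qed.

Lemma dihedral_mulX i : b * a ^+ i = a ^- i * b.
Proof.
have bV: b^-1 = b by apply/eqP; rewrite eq_invg_mul -expg2 b_2.
by rewrite -expVgn -dihedral_conj -conjXg conjgE bV -!mulgA -(expg2 b) b_2 mulg1.
Qed.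

Lemma dihedral_invol v : v \notin <[a]> -> v ^+ 2 = 1.
Proof.
move=> nav; have: v \in <[a]> * <[b]> by rewrite dihedral_mul inE.
have [_ ob _] := dihedral_orders; case/mulsgP=> x y ax; rewrite cycle2g // => /set2P[] -> vE.
  by rewrite vE mulg1 ax in nav.
case/cycleP: ax vE => i -> ->.
by rewrite expg2 -mulgA (mulgA b) dihedral_mulX -!mulgA -(expg2 b) b_2 mulg1 mulgV.
Qed.

End Elements.

Lemma dihedral_isom (a b a' b' : gT) :
  a ^+ n = 1 -> b ^+ 2 = 1 -> b * a * b * a = 1 -> <<[set a; b]>> = [set: gT] ->
  a' ^+ n = 1 -> b' ^+ 2 = 1 -> b' * a' * b' * a' = 1 ->
  <<[set a'; b']>> = [set: gT] ->
  exists h : {morphism [set: gT] >-> gT},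
    [/\ isom [set: gT] [set: gT] h, h a = a' & h b = b'].
Proof.
move=> an b2 ba gen an' b2' ba' gen'.
have [oa ob ti] := dihedral_orders an b2 ba gen.
have [oa' ob' ti'] := dihedral_orders an' b2' ba' gen'.
have da: #[a'] %| #[a] by rewrite oa oa'.
have db: #[b'] %| #[b] by rewrite ob ob'.
have nab: <[b]> \subset 'N(<[a]>).
  by rewrite cycle_subG inE -cycleJ dihedral_conj ?cycleV.
have defT: <[a]> ><| <[b]> = [set: gT]%G by rewrite sdprodE ?dihedral_mul.
have act: {in <[a]> & <[b]>, morph_act 'J 'J (eltm da) (eltm db)}.
  move=> _ y /cycleP[i ->]; rewrite cycle2g // => /set2P[] -> /=.
    by rewrite morph1 !conjg1.
  rewrite eltm_id eltmE !conjXg !dihedral_conj // morphX ?groupV ?cycle_id //.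
  by rewrite morphV ?cycle_id //= eltm_id.
exists [morphism of sdprodm defT act]; split.
- apply/isomP; split.
    rewrite injm_sdprodm !injm_eltm oa oa' ob ob' !dvdnn !im_eltm /=.
    by rewrite ti'.
  by rewrite im_sdprodm !im_eltm dihedral_mul.
- by rewrite /= sdprodmEl ?cycle_id //= eltm_id.
by rewrite /= sdprodmEr ?cycle_id //= eltm_id.
Qed.

End DihedralPair.

(** * Transport of Cayley maps and the classification on dihedral groups *)

Lemma cayley_map_transport (gT : finGroupType) (M : cayley_map gT)
    (h : {morphism [set: gT] >-> gT}) : isom [set: gT] [set: gT] h ->
  exists N : cayley_map gT, [/\ cm_set N = h @: cm_set M,
    forall x, cm_perm N (h x) = h (cm_perm M x) & cm_equiv M N].
Proof.
move=> iso; have [inj_h im_h] := isomP iso.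
have injh: injective h by move=> x y; apply: (injmP inj_h); rewrite inE.
pose s := perm injh; pose X := h @: cm_set M.
have [q qE]: exists q : {perm gT}, forall x, q (h x) = h (cm_perm M x).
  by exists (cm_perm M ^ s) => x; rewrite -[h x](permE injh) permJ permE.
have hX x : (h x \in X) = (x \in cm_set M) by rewrite mem_imset.
have hV x : exists y, x = h y.
  have: x \in h @* [set: gT] by rewrite im_h inE.
  by case/morphimP=> y _ _ ->; exists y.
have hinv x : h x^-1 = (h x)^-1 by rewrite morphV ?inE.
have genX: <<X>> = [set: gT].
  by rewrite /X -[h @: _]morphimEsub ?subsetT // -morphim_gen ?subsetT // cm_gen im_h.
have invX: X^-1 = X.
  apply/setP=> x; have [y ->] := hV x.
  by rewrite inE -hinv !hX -{1}(cm_inv M) inE invgK.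
have not1: 1 \notin X by rewrite -(morph1 h) hX (cm_not1 M).
have onX: perm_on X q.
  apply/subsetP=> x; have [y ->] := hV x; rewrite inE qE (inj_eq injh) hX => ny.
  by apply: (subsetP (cm_on M)).
have qXE i x : (q ^+ i) (h x) = h ((cm_perm M ^+ i) x).
  by elim: i => [|i IH]; rewrite ?perm1 // !expgSr !permM IH qE.
have cycX: {in X, forall x, porbit q x = X}.
  move=> _ /imsetP[y My ->]; apply/setP=> v; have [u ->] := hV v; rewrite hX.
  rewrite -(cm_cyclic My); apply/porbitP/porbitP=> -[i e]; exists i.
    by move: e; rewrite qXE => /injh.
  by rewrite qXE e.
exists (CayleyMap genX invX not1 onX cycX); split=> //=.
by exists h; split=> //= x _; rewrite qE.
Qed.

Lemma left_mulE (gT : finGroupType) (g x : gT) : left_mul g x = g * x.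
Proof. exact: permE. Qed.

Lemma left_mulX (gT : finGroupType) (g x : gT) i : (left_mul g ^+ i) x = g ^+ i * x.
Proof.
elim: i => [|i IH]; first by rewrite perm1 mul1g.
by rewrite expgSr permM IH left_mulE expgS mulgA.
Qed.

Lemma left_mul_inj (gT : finGroupType) : injective (@left_mul gT).
Proof. by move=> g h /permP/(_ 1); rewrite !left_mulE !mulg1. Qed.

Theorem theorem3p4 (n : nat) (hn : 5 <= n)
    (a b : 'D_(n.*2)) (hab : dihedral_generators a b)
    (M : cayley_map 'D_(n.*2)) (hreg : regular_map M)
    (C : {group {perm 'D_(n.*2)}})
    (hCL : C \subset left_regular 'D_(n.*2)) (hCcyc : cyclic C) (hCn : #|C| = n)
    (hcore : gcore C (vertex_aut M) = 1) :
  (exists m : nat, n = (2 * m)%N /\ odd m) /\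
  (exists N : cayley_map 'D_(n.*2),
    [/\ cm_set N = (a *: <[a ^+ 2]>) :|: (b *: <[a ^+ 2]>),
        (forall j : nat, ~~ odd j -> cm_perm N (a ^+ j * b) = a ^+ j.+1),
        (forall j : nat, odd j -> cm_perm N (a ^+ j) = a ^+ j.+1 * b)
      & cm_equiv M N]).
Proof.
case: hab => an b2 bab genab.
have n_gt0: 0 < n by apply: leq_trans hn.
have cT: #|[set: 'D_(n.*2)]| = n.*2 by rewrite card_dihedral // (leq_trans _ hn).
have [oa ob tiab] := dihedral_orders n_gt0 cT an b2 bab genab.
have cA: #|<[a]>| = n := oa.
pose D := left_regular_group ('D_(n.*2))%type.
have cD: #|D| = n.*2 by rewrite card_imset -?cardsT //; apply: left_mul_inj.
have defC: C :=: @left_mul _ @: <[a]>.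
  (* A generator of [C] translates by some [v]; outside [<[a]>] it would be an involution, against
     [n >= 5]. *)
  apply/eqP; rewrite eqEcard card_imset ?cA ?hCn ?leqnn ?andbT; last exact: left_mul_inj.
  have [c cE] := cyclicP hCcyc; have Cc: c \in C by rewrite cE cycle_id.
  have /imsetP[v _ vE] := subsetP hCL _ Cc.
  have av: v \in <[a]>.
    apply: contraTT hn => /(dihedral_invol n_gt0 cT an b2 bab genab) v2.
    have: #[c] <= 2.
      rewrite dvdn_leq // order_dvdn; apply/eqP/permP=> x.
      by rewrite vE left_mulX v2 perm1 mul1g.
    by rewrite orderE -cE hCn -leqNgt => n2; apply: leq_trans n2 _.
  rewrite cE; apply/subsetP=> _ /cycleP[i ->]; apply/imsetP; exists (v ^+ i).
    exact: groupX.
  by apply/permP=> x; rewrite vE left_mulX left_mulE.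
have memC v : (left_mul v \in C) = (v \in <[a]>).
  by rewrite defC mem_imset //; apply: left_mul_inj.
have [b0 Xb0 nb0]: exists2 b0, b0 \in cm_set M & b0 \notin <[a]>.
  apply/subsetPn; apply: contraTN hn; rewrite -gen_subG (cm_gen M) => /subset_leq_card.
  by rewrite cT cA -addnn -{3}(addn0 n) leq_add2l leqn0 => /eqP ->.
have [f Af [f1 fX]] := rotation_aut Xb0 hreg.
have f1X i : (f ^+ i) 1 = 1 by elim: i => [|i IH]; rewrite ?perm1 // expgSr permM IH.
have fpX i x : x \in cm_set M -> (f ^+ i) x = (cm_perm M ^+ i) x.
  move=> Xx; elim: i => [|i IH]; first by rewrite !perm1.
  by rewrite !expgSr !permM IH fX // cm_permX_closed.
pose G := vertex_aut_group M; pose t := left_mul b0.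
have sDG: D \subset G := left_regular_sub M.
have DL g : left_mul g \in D by apply: imset_f.
have GL g : left_mul g \in G := subsetP sDG _ (DL g).
(* [f] permutes X as one cycle, so [s] agrees with a power of [f] on [b0], and rigidity at that arc
   gives equality. *)
have stab s : s \in G -> s 1 = 1 -> s \in <[f]>.
  move=> As s1; have [Xs _] := vertex_autP As 1 Xb0; rewrite s1 invg1 !mul1g in Xs.
  have [i ei] := cm_permX Xb0 Xs; apply/cycleP; exists i.
  apply/eqP; rewrite eq_mulgV1; apply/eqP/(vertex_aut_fix _ Xb0).
  - by rewrite groupM ?groupV ?groupX.
  - by have := permK (f ^+ i) 1; rewrite f1X permM s1.
  by rewrite permM ei -fpX // permK.
have defG: <[f]> * D = G.
  apply/eqP; rewrite eqEsubset mul_subG ?cycle_subG //=; apply/subsetP=> s Gs.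
  rewrite -[s](mulgKV (left_mul (s 1))) mem_mulg // stab ?groupM ?groupV ?GL //.
  by have := permK (left_mul (s 1)) 1; rewrite left_mulE mulg1 permM.
have tiBD: <[f]> :&: D = 1.
  apply/trivgP/subsetP=> _ /setIP[/cycleP[i ->] /imsetP[g _ e]]; apply/set1gP.
  have := f1X i; rewrite e left_mulE mulg1 => ->.
  by apply/permP=> x; rewrite left_mulE mul1g perm1.
have cardD: #|D| = #|C|.*2 by rewrite cD hCn.
have invol: {in D :\: C, forall d, d ^+ 2 = 1}.
  move=> _ /setDP[/imsetP[v _ ->]]; rewrite memC => nav; apply/permP=> x.
  by rewrite left_mulX (dihedral_invol n_gt0 cT an b2 bab genab nav) mul1g perm1.
have Dt: t \in D :\: C by rewrite inE memC nb0 DL.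
have tE : t 1 = b0 by rewrite left_mulE mulg1.
have genG: <<[set f; t]>> = G.
  apply/eqP; rewrite eqEsubset gen_subG subUset !sub1set Af (subsetP sDG) ?DL //=.
  pose K := <<[set f; t]>>%G.
  have Kf: f \in K by rewrite mem_gen ?set21.
  have Kt: t \in K by rewrite mem_gen ?set22.
  have sBK: <[f]> \subset K by rewrite cycle_subG.
  rewrite -[vertex_aut M]/(gval G) -defG mul_subG //.
  have KX x : x \in cm_set M -> left_mul x \in K.
    move=> Xx; have [i xE] := cm_permX Xb0 Xx.
    (* [t * f ^+ i] and the translation by [x] both send 1 to [x]. *)
    have: t * f ^+ i * (left_mul x)^-1 \in <[f]>.
      apply: stab.
        by apply: groupM; [apply: groupM; [exact: GL | exact: groupX] | rewrite groupV GL].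
      by have := permK (left_mul x) 1; rewrite left_mulE mulg1 !permM tE fpX // -xE.
    move/(subsetP sBK); rewrite groupMl; first by rewrite groupV.
    by rewrite groupM ?groupX.
  have KH: group_set [set v | left_mul v \in K].
    apply/group_setP; split=> [|u v]; rewrite !inE.
      have -> : left_mul 1 = 1 :> {perm 'D_(n.*2)} by apply/permP=> x; rewrite left_mulE mul1g perm1.
      exact: group1.
    move=> Ku Kv; have -> : left_mul (u * v) = left_mul v * left_mul u.
      by apply/permP=> x; rewrite permM !left_mulE mulgA.
    exact: groupM.
  have: cm_set M \subset Group KH by apply/subsetP=> x Xx; rewrite inE KX.
  rewrite -gen_subG cm_gen => /subsetP sT.
  by apply/subsetP=> _ /imsetP[v _ ->]; have := sT v (in_setT v); rewrite inE.
have tiBt: <[f]> :&: <[f]> :^ t = 1.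
  apply/trivgP/subsetP=> s /setIP[Bs]; rewrite mem_conjg => Bst; apply/set1gP.
  case/cycleP: Bs Bst => i -> /cycleP[j e].
  have := congr1 (fun q : {perm _} => (q * t) 1) e.
  rewrite /= conjgE invgK -!mulgA mulVg mulg1 !permM f1X tE => e1.
  by apply: (vertex_aut_fix _ Xb0); rewrite ?groupX.
have coreC (E : {group {perm 'D_(n.*2)}}) : E \subset C -> f \in 'N(E) -> E :=: 1.
  move=> sEC nEf; have sGN: G \subset 'N(E).
    rewrite -defG mul_subG ?cycle_subG //.
    by apply: (nCsubD (C := C)) => //; rewrite hCn.
  by apply/trivgP; rewrite -hcore; apply: gcore_max.
have C5: 5 <= #|C| by rewrite hCn.
have [m [nE om [al [be [u [Cal Dbe Bu trE]]]]]] :=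
  factorization_structure defG tiBD hCL hCcyc C5 cardD invol Dt genG tiBt coreC.
rewrite hCn in nE; split; first by exists m.
have Ca: al \in C by rewrite Cal cycle_id.
have /imsetP[x _ alE] := subsetP hCL _ Ca.
have /imsetP[y _ beE]: be \in D by case/setDP: Dbe.
case/cycleP: Bu => l uE; pose y0 := (cm_perm M ^+ l) b0.
have Xy0: y0 \in cm_set M by apply: cm_permX_closed.
(* Evaluating [t * (u * f ^+ j) = w * tr _] at the vertex 1, fixed by [w], turns [tr] into an
   iterate of the rotation of X. *)
have pE j : (cm_perm M ^+ j) y0 = if odd j then x ^+ j else x ^+ j * y.
  have [w Bw e] := trP defG Dt (groupM (mem_cycle f l) (mem_cycle f j)).
  have := congr1 (fun q : {perm _} => q 1) e; rewrite -uE trE.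
  case/cycleP: Bw => i ->; rewrite !permM tE f1X uE fpX // fpX // => ->.
  case: (odd j); rewrite ?permM alE ?beE ?left_mulX ?left_mulE ?mulg1 //.
have yE: y = y0 by have := pE 0; rewrite perm1 /= mul1g.
have oal: #[al] = n by rewrite orderE -Cal hCn.
have xn: x ^+ n = 1.
  have: al ^+ n = 1 by apply/eqP; rewrite -order_dvdn oal.
  by move/permP/(_ 1); rewrite alE left_mulX mulg1 perm1.
have y2: y ^+ 2 = 1.
  by have := invol _ Dbe; move/permP/(_ 1); rewrite beE left_mulX mulg1 perm1.
have yxyx: y * x * y * x = 1.
  have := invol _ (mulDC' hCL Dbe Ca) => /permP/(_ 1).
  rewrite expg2 !permM alE beE !left_mulE mulg1 perm1 => /(canRL (mulKg _)) e.
  by rewrite -(mulgA y) e mulg1 mulVg.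
have ox: #[x] = n.
  apply: etrans oal; apply/eqP; rewrite eqn_dvd !order_dvdn.
  apply/andP; split; apply/eqP.
    have := congr1 (fun q : {perm _} => q 1) (expg_order al).
    by rewrite /= {1}alE left_mulX mulg1 perm1.
  by apply/permP=> v; rewrite {1}alE left_mulX expg_order perm1 mul1g.
have genxy: <<[set x; y]>> = [set: 'D_(n.*2)].
  pose K := <<[set x; y]>>%G; have sxK: <[x]> \subset K by rewrite cycle_subG mem_gen ?set21.
  have nxy: y \notin <[x]>.
    apply: contraTN Dbe => /cycleP[i yi]; rewrite inE Cal; apply/negP=> /andP[/negP[]].
    by rewrite beE yi -[left_mul _](_ : al ^+ i = _) ?mem_cycle //; apply/permP=> v; rewrite alE left_mulX left_mulE.
  have ltK: n < #|K|.
    have: #|<[x]>| < #|K|; last by rewrite -orderE ox.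
    rewrite proper_card // properE sxK; apply/subsetPn; exists y => //.
    by rewrite mem_gen ?set22.
  have: #|K| %| n.*2 by apply: dvdn_trans (cardSg (subsetT K)) _; rewrite cT.
  have := cardSg sxK; rewrite -orderE ox => /dvdnP[q qE] /dvdn_leq; rewrite double_gt0 => /(_ n_gt0) leK.
  apply/eqP; rewrite eqEcard subsetT cT -[#|_|]/#|K| qE.
  by move: ltK; rewrite qE -mul2n leq_pmul2r // -{1}(mul1n n) ltn_pmul2r.
have [h [iso hx hy]] := dihedral_isom n_gt0 cT xn y2 yxyx genxy an b2 bab genab.
have [N [NX NE eqN]] := cayley_map_transport M iso; exists N.
have hE j : h ((cm_perm M ^+ j) y0) = if odd j then a ^+ j else a ^+ j * b.
  rewrite pE; case: (odd j); rewrite ?morphM ?morphX ?inE // hx ?hy //.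
have NpE j : cm_perm N (h ((cm_perm M ^+ j) y0)) = if odd j then a ^+ j.+1 * b else a ^+ j.+1.
  by rewrite NE -permM -expgSr hE /=; case: (odd j).
split=> // [|j oj|j oj]; last 2 first.
- by have := NpE j; rewrite hE (negbTE oj).
- by have := NpE j; rewrite hE oj.
have a2X i : a ^+ (2 * i) = (a ^+ 2) ^+ i by rewrite expgM.
have mulX := dihedral_mulX b2 bab.
rewrite NX; apply/setP=> v; apply/imsetP/setUP.
  case=> z Xz ->; have [j ->] := cm_permX Xy0 Xz; rewrite hE.
  have := odd_double_half j; rewrite -mul2n; case: (odd j) => <-; [left | right].
    by rewrite mem_lcoset expgD mulKg a2X mem_cycle.
  rewrite mem_lcoset add0n -conjgE a2X !conjXg (dihedral_conj b2 bab) expVgn.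
  by rewrite groupX // groupV cycle_id.
case=> /lcosetP[_ /cycleP[i ->] ->].
  exists ((cm_perm M ^+ (2 * i).+1) y0); first exact: cm_permX_closed.
  by rewrite hE /= oddM /= (expgS a (2 * i)) a2X.
(* Since [b * a ^+ (2 * i) = a ^- (2 * i) * b], the preimage needs a nonnegative exponent for
   [a ^- (2 * i)]. *)
have /cycleP[l' e]: a ^- (2 * i) \in <[a ^+ 2]> by rewrite groupV a2X mem_cycle.
exists ((cm_perm M ^+ (2 * l')) y0); first exact: cm_permX_closed.
by rewrite hE oddM /= -a2X mulX e a2X.
Qed.
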